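(* For every integer $n\geq 12$ and every integer $r$ with $3\leq r\leq \lfloor (n-1)/2\rfloor$, the alternating group $A_n$ has at least one string C-group representation of rank $r$; that is, there exist involutions $\rho_0,\dots,\rho_{r-1}\in A_n$ generating $A_n$ such that $(A_n,(\rho_0,\dots,\rho_{r-1}))$ is a string C-group.
   Context: A string group generated by involutions (sggi) of rank $r$ is a pair $(G,(\rho_0,\dots,\rho_{r-1}))$ where $\rho_0,\dots,\rho_{r-1}$ are involutions generating the group $G$ such that $(\rho_i\rho_j)^2=1$ whenever $|i-j|\geq 2$. It is a string C-group (a string C-group representation of $G$ of rank $r$) if in addition it satisfies the intersection property: for all $J,K\subseteq\{0,\dots,r-1\}$, $\langle \rho_j : j\in J\rangle\cap\langle\rho_k : k\in K\rangle=\langle \rho_j : j\in J\cap K\rangle$. *)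

(* Defs.v *)
From HB Require Import structures.
From mathcomp Require Import all_boot all_fingroup all_solvable.
Set Implicit Arguments. Unset Strict Implicit. Unset Printing Implicit Defensive.
Local Open Scope group_scope.

Definition sggi (gT : finGroupType) (G : {set gT}) (r : nat) (rho : 'I_r -> gT) : Prop :=
  [/\ (forall i, rho i != 1 /\ rho i ^+ 2 = 1),
      <<[set rho i | i : 'I_r]>> = G &
      (forall i j : 'I_r, ((1 < i - j) || (1 < j - i))%N -> (rho i * rho j) ^+ 2 = 1)].

Definition intersection_property (gT : finGroupType) (r : nat) (rho : 'I_r -> gT) : Prop :=
  forall J K : {set 'I_r},
    <<rho @: J>> :&: <<rho @: K>> = <<rho @: (J :&: K)>>.

Definition string_C_group (gT : finGroupType) (G : {set gT}) (r : nat) (rho : 'I_r -> gT) : Prop :=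
  sggi G rho /\ intersection_property rho.

(* Main.v *)
Require Import Defs.
From HB Require Import structures.
From mathcomp Require Import all_boot all_fingroup all_solvable.
From mathcomp Require Import zify.
(** Let [q] be a string C-group of even permutations of [A] in which only [q 0] moves the point
[v], and suppose that an element of <q_0, ..., q_j> supported on the orbit of [v] under
<q_0, ..., q_{j-1}> already lies in the latter group (a "piece" at [v]).  If two pieces meet
exactly in [v], then the sequence t_{k-1}, ..., t_0, q_0, ..., q_{s-1} is a string C-group: the
commutator of t_0 and q_0 is a 3-cycle through [v], so <t_0, ..., t_{a-1}, q_0, ..., q_{b-1}>
(a, b > 0) contains every even permutation of the union of the two orbits of [v], and the
intersection property follows from the star condition at the ends.  The whole group is the
alternating group of the union.

For each residue of [n] modulo 4 suitable pieces (a path, two "ladder" families of signed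
permutations, and four regular polytopes of small degree) give alternating groups of the highest
rank; for [n] = 1 mod 4 the highest rank needs a separate family.  In a simple string C-group,
replacing rho_0, rho_1, rho_2, rho_3, ... by rho_1, rho_0 rho_2, rho_3, ... lowers the rank by one
as soon as rho_2 rho_3 has odd order (rank reduction of Brooksbank and Leemans), and iterating
this covers the remaining ranks. *)

(** High rank means one generator for about every two points. Ladders achieve this: the columns have
    two points each, generators swap adjacent columns, and one of them also flips columns, so that
    the group is transitive on points and not only on columns. A flip of m columns is a product of m
    transpositions, so evenness restricts the number of columns, and this is why the residue of the
    degree matters. The flip has a price: in both ladder families the twisted generator and its
    successor have a product of even order, so contraction must stop before reaching them, and glued
    ladders give only ranks from six or seven upwards. Smaller ranks come from a path of rank two,
    whose length absorbs any multiple of four points at constant rank, glued to a small piece. There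
    contraction runs through the small piece, so the polytopes used for it have products of orders 3
    and 5. Degree 12 leaves no room for a path next to the icosahedron and gets its own example. *)

Set Implicit Arguments. Unset Strict Implicit. Unset Printing Implicit Defensive.
Local Open Scope group_scope.

(** * String C-groups *)

Section Windows.
Variable gT : finGroupType.
Implicit Types (rho : nat -> gT) (J K : pred nat) (H : {group gT}).

(** Generators are indexed by [nat] and restricted to a window, so that shifting, reversing and
    gluing sequences need no casts between ordinal types. *)
Definition wgen rho i j J : {set gT} :=
  <<[set rho (val k) | k : 'I_j & (i <= k) && J k]>>.
Canonical wgen_group rho i j J := Eval hnf in [group of wgen rho i j J].

Definition itv rho i j := wgen rho i j predT.
Canonical itv_group rho i j := Eval hnf in [group of itv rho i j].

Lemma mem_wgen rho i j J k : i <= k -> k < j -> J k -> rho k \in wgen rho i j J.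
Proof.
move=> ik kj Jk; apply/mem_gen/imsetP; exists (Ordinal kj) => //.
by rewrite inE ik.
Qed.

Lemma wgen_sub rho i j J H :
  (forall k, i <= k -> k < j -> J k -> rho k \in H) -> wgen rho i j J \subset H.
Proof.
move=> hH; rewrite gen_subG; apply/subsetP=> _ /imsetP[k + ->].
by rewrite inE => /andP[ik Jk]; apply: hH; rewrite ?ltn_ord.
Qed.

Lemma wgenS rho i j J i' j' K :
    (forall k, i <= k -> k < j -> J k -> [&& i' <= k, k < j' & K k]) ->
  wgen rho i j J \subset wgen rho i' j' K.
Proof.
move=> h; apply: wgen_sub => k ik kj Jk.
by have /and3P[? ? ?] := h k ik kj Jk; apply: mem_wgen.
Qed.

Lemma mem_itv rho i j k : i <= k -> k < j -> rho k \in itv rho i j.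
Proof. by move=> ik kj; apply: mem_wgen. Qed.

Lemma itv_sub rho i j H :
  (forall k, i <= k -> k < j -> rho k \in H) -> itv rho i j \subset H.
Proof. by move=> h; apply: wgen_sub => k ik kj _; apply: h. Qed.

Lemma itvS rho i j i' j' : i' <= i -> j <= j' -> itv rho i j \subset itv rho i' j'.
Proof. by move=> hi hj; apply: wgenS => k; lia. Qed.

Lemma itv_nil rho i j : j <= i -> itv rho i j = 1.
Proof.
move=> ji; apply/trivgP; apply: (@itv_sub _ _ _ 1%G) => k; lia.
Qed.

Definition string_commute rho r :=
  forall i j, i.+1 < j -> j < r -> commute (rho i) (rho j).

(* The instances of the intersection property that imply all the others, see [wgenI]. *)
Definition itv_ip rho r := forall i j, i.+2 <= j -> j <= r ->
  itv rho i j.-1 :&: itv rho i.+1 j \subset itv rho i.+1 j.-1.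

(** [itv_ip] puts the element in the window shortened at both ends; three uses of induction on
    shorter windows then trim it to the common part. *)
Lemma itvI rho r i j i' j' : itv_ip rho r -> i <= i' -> j' <= j -> j <= r ->
  itv rho i j' :&: itv rho i' j \subset itv rho i' j'.
Proof.
move=> ip; have [d] := ubnP (j - i); elim: d i j i' j' => // d IH i j i' j' hd.
move=> ii' j'j jr.
have [->|ni] := eqVneq i i'; first exact: subsetIl.
have [->|nj] := eqVneq j' j; first exact: subsetIr.
have [ji'|i'j] := leqP j i'.
  by rewrite (itv_nil rho ji'); apply: subset_trans (subsetIr _ _) (sub1G _).
apply/subsetP=> x /setIP[x1 x2].
have x3 : x \in itv rho i.+1 j.-1.
  apply: (subsetP (ip i j _ jr)); first lia.
  rewrite inE (subsetP (itvS _ _ _) _ x1) ?(subsetP (itvS _ _ _) _ x2) //; lia.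
have x4 : x \in itv rho i.+1 j'.
  apply: (subsetP (IH i j.-1 i.+1 j' _ _ _ _)); rewrite ?inE ?x1 //; lia.
have x5 : x \in itv rho i' j.-1.
  apply: (subsetP (IH i.+1 j i' j.-1 _ _ _ _)); rewrite ?inE ?x3 //; lia.
apply: (subsetP (IH i.+1 j.-1 i' j' _ _ _ _)); rewrite ?inE ?x4 //; lia.
Qed.

Lemma wgen_commute rho r i a b j J K : string_commute rho r ->
  a < b -> j <= r -> wgen rho i a J \subset 'C(wgen rho b j K).
Proof.
move=> comm ab jr; apply: wgen_sub => k ik ka _.
rewrite -sub_cent1; apply: wgen_sub => l bl lj _.
by apply/cent1P/commute_sym/comm; lia.
Qed.

(** Without the index [a], the generators fall into two blocks that commute elementwise, so the join
    is a product. *)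
Lemma wgen_split rho r i a j J : string_commute rho r ->
  i <= a -> a < j -> j <= r -> ~~ J a ->
  wgen rho i j J \subset wgen rho i a J * wgen rho a.+1 j J.
Proof.
move=> comm ia aj jr Ja.
have cC := wgen_commute i J J comm (ltnSn a) jr.
rewrite -(cent_joinEl cC).
apply: wgen_sub => k ik kj Jk.
have [ka|ak|eka] := ltngtP k a.
- by rewrite (subsetP (joing_subl _ _)) // mem_wgen.
- by rewrite (subsetP (joing_subr _ _)) // mem_wgen.
- by rewrite -eka Jk in Ja.
Qed.

(** Induction on the window. If [J] misses [a] and [K] misses [b], an element of both groups factors
    at [a] and at [b]; comparing the two factorisations reduces the claim to shorter windows. *)
Lemma wgenI rho r i j J K : string_commute rho r -> itv_ip rho r -> j <= r ->
  wgen rho i j J :&: wgen rho i j K \subset wgen rho i j [pred k | J k && K k].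
Proof.
move=> comm ip; have [d] := ubnP (j - i).
elim: d i j J K => // d IH i j J K hd jr.
case: (boolP [forall k : 'I_j, (i <= k) ==> J k]) => [/forallP aJ|].
  apply: subset_trans (subsetIr _ _) _; apply: wgenS => k ik kj Kk /=.
  by rewrite ik kj Kk (implyP (aJ (Ordinal kj))).
case: (boolP [forall k : 'I_j, (i <= k) ==> K k]) => [/forallP aK _|].
  apply: subset_trans (subsetIl _ _) _; apply: wgenS => k ik kj Jk /=.
  by rewrite ik kj Jk (implyP (aK (Ordinal kj))).
rewrite !negb_forall => /existsP[[b /= bj]]; rewrite negb_imply => /andP[ib Kb].
case/existsP=> [[a /= aj]]; rewrite negb_imply => /andP[ia Ja].
wlog ab : a b J K aj bj ia ib Ja Kb / a <= b.
  move=> W; case/orP: (leq_total a b) => [ab|ba].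
    exact: (W a b).
  rewrite setIC; apply: subset_trans (W b a K J bj aj ib ia Kb Ja ba) _.
  by apply: wgenS => k -> -> /andP[/= -> ->].
have [d1 d2 d3] : [/\ a - i < d, j - a.+1 < d & b - i < d] by split; lia.
have [ar bj'] : a <= r /\ b <= r by split; lia.
have ab1 : a.+1 <= b.+1 by lia.
apply/subsetP=> x /setIP[xJ xK].
have /mulsgP[u w uJ wJ def_x] := subsetP (wgen_split comm ia aj jr Ja) _ xJ.
have /mulsgP[u' w' uK wK def_x'] := subsetP (wgen_split comm ib bj jr Kb) _ xK.
have toT i1 j1 J1 : wgen rho i1 j1 J1 \subset itv rho i1 j1.
  by apply: wgenS => k -> ->.
have up i1 j1 i2 j2 J1 z : i2 <= i1 -> j1 <= j2 -> z \in wgen rho i1 j1 J1 ->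
    z \in itv rho i2 j2.
  by move=> h1 h2 zJ; apply: (subsetP (itvS _ h1 h2)); apply: (subsetP (toT _ _ J1)).
(* The discrepancy of the two factorisations lies in a window ending before [b] and in one starting
   after [a], hence strictly between the two gaps. *)
pose e := u'^-1 * u.
have def_e : e = w' * w^-1.
  by apply: (mulgI u'); rewrite /e mulKVg mulgA -def_x' def_x mulgK.
have eT : e \in itv rho a.+1 b.
  apply: (subsetP (itvI ip (leqW ia) (ltnW bj) jr)); rewrite inE; apply/andP; split.
    by rewrite groupM ?groupV // ?(up _ _ _ _ _ _ _ _ uJ) ?(up _ _ _ _ _ _ _ _ uK).
  rewrite def_e groupM ?groupV //.
    exact: up wK.
  exact: up wJ.
have u'E : u' = u * e^-1 by rewrite /e invMg invgK mulKVg.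
(* [J'] records what [u' = u * e^-1] can involve: [J] below [a], never [a] itself, anything
   above. *)
pose J' := [pred k | if k < a then J k else a < k].
have u'J : u' \in wgen rho i b J'.
  rewrite u'E groupM ?groupV //.
    by apply: (subsetP (wgenS _ _)) uJ => k /= ik ka Jk; rewrite ik ka Jk (leq_trans ka ab).
  apply: (subsetP (wgenS _ _)) eT => k /= ak kb _.
  by rewrite kb ltnNge (ltnW ak) ak /= (leq_trans ia (ltnW ak)).
have u'JK : u' \in wgen rho i b [pred k | J' k && K k].
  by apply: (subsetP (IH i b J' K d3 bj')); rewrite inE u'J.
have IHm i1 j1 J1 K1 z : j1 - i1 < d -> j1 <= r -> z \in wgen rho i1 j1 J1 ->
    z \in wgen rho i1 j1 K1 -> z \in wgen rho i1 j1 [pred k | J1 k && K1 k].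
  by move=> h1 h2 z1 z2; apply: (subsetP (IH _ _ J1 K1 h1 h2)); rewrite inE z1.
have joinJK y z : y \in wgen rho i a [pred k | J k && K k] ->
    z \in wgen rho a.+1 j [pred k | J k && K k] ->
  y * z \in wgen rho i j [pred k | J k && K k].
  move=> hy hz; rewrite groupM //.
    by apply: (subsetP (wgenS _ _)) hy => k -> ka ->; rewrite (ltn_trans ka aj).
  by apply: (subsetP (wgenS _ _)) hz => k ak -> ->; rewrite (leq_trans ia (ltnW ak)).
have [ab'|ba] := ltnP a b; last first.
  have eab : b = a by apply/eqP; rewrite eqn_leq ab ba.
  have e1 : e = 1 by move: eT; rewrite (itv_nil rho (leqW ba)) => /set1P.
  have uu' : u' = u by rewrite u'E e1 invg1 mulg1.
  have ww' : w' = w by apply/eqP; rewrite eq_mulgV1 -def_e e1.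
  rewrite eab uu' in uK; rewrite eab ww' in wK.
  rewrite def_x; apply: joinJK; first exact: (IHm i a J K u d1 ar uJ uK).
  exact: (IHm a.+1 j J K w d2 jr wJ wK).
have J'a : ~~ [pred k | J' k && K k] a by rewrite /= ltnn.
have /mulsgP[u1 w1 u1P w1P u'def] := subsetP (wgen_split comm ia ab' bj' J'a) _ u'JK.
have w1e : u1^-1 * u = w1 * e.
  by apply: (mulgI u1); rewrite mulKVg mulgA -u'def u'E mulgKV.
have u1JK : u1 \in wgen rho i a [pred k | J k && K k].
  by apply: (subsetP (wgenS _ _)) u1P => k /= ik ka; rewrite ik ka.
have w1K : w1 \in wgen rho a.+1 b K.
  by apply: (subsetP (wgenS _ _)) w1P => k /= ik ka /andP[_ ->]; rewrite ik ka.
(* This window is empty, so [u = u1]; then [e^-1 = w1] uses only generators in [K], and so does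
   [w]. *)
have : u1^-1 * u \in itv rho a.+1 a.
  apply: (subsetP (itvI ip (leqW ia) (ltnW aj) jr)); rewrite inE; apply/andP; split.
    by rewrite groupM ?groupV ?(up _ _ _ _ _ _ _ _ uJ) ?(up _ _ _ _ _ _ _ _ u1P).
  rewrite w1e groupM //; first by apply: up w1K => //; apply: ltnW.
  by apply: (subsetP (itvS _ _ _)) eT => //; apply: ltnW.
rewrite itv_nil // => /set1P u1u.
have uu1 : u = u1 by apply: (mulgI u1^-1); rewrite u1u mulVg.
have de : e^-1 = w1 by apply: (mulIg e); rewrite mulVg -w1e.
have wK' : w \in wgen rho a.+1 j K.
  have -> : w = e^-1 * w' by rewrite def_e invMg invgK mulgKV.
  rewrite de groupM //.
    by apply: (subsetP (wgenS _ _)) w1K => k -> kb ->; rewrite (ltn_trans kb bj).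
  by apply: (subsetP (wgenS _ _)) wK => k bk -> ->; rewrite (leq_trans ab1 bk).
rewrite def_x; apply: joinJK; first by rewrite uu1.
exact: (IHm a.+1 j J K w d2 jr wJ wK').
Qed.
End Windows.

Section StringC.
Variable gT : finGroupType.
Implicit Types (rho : nat -> gT) (J K : pred nat).

Definition involutive_gens rho r :=
  forall i, i < r -> rho i != 1 /\ rho i * rho i = 1.

Definition stringC rho r :=
  [/\ involutive_gens rho r, string_commute rho r & itv_ip rho r].

Lemma stringC_group rho r : stringC rho r ->
  string_C_group (itv rho 0 r) (fun i : 'I_r => rho i).
Proof.
case=> inv comm ip; split; first split.
- by move=> i; exact: inv (ltn_ord i).
- by congr (generated _); apply/setP=> x; apply/imsetP/imsetP=> -[i _ ->]; exists i; rewrite ?inE.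
- move=> i j ij; have cij : commute (rho i) (rho j).
    by case/orP: ij => h; [apply: commute_sym|]; apply: comm; rewrite ?ltn_ord //; lia.
  have [[_ i1] [_ j1]] := (inv i (ltn_ord i), inv j (ltn_ord j)).
  by rewrite expgMn // (i1 : rho i ^+ 2 = 1) (j1 : rho j ^+ 2 = 1) mulg1.
move=> J K.
have toW (A : {set 'I_r}) :
    <<(fun i : 'I_r => rho i) @: A>> = wgen rho 0 r [pred k | [exists i in A, val i == k]].
  congr (generated _); apply/setP=> x; apply/imsetP/imsetP=> -[i iA ->]; exists i => //.
    by rewrite inE /=; apply/existsP; exists i; rewrite iA eqxx.
  move: iA; rewrite inE /= => /existsP[k /andP[kA /eqP ki]].
  by have -> : i = k by apply: val_inj.
apply/eqP; rewrite eqEsubset; apply/andP; split; last first.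
  by rewrite subsetI !genS // imsetS ?subsetIl ?subsetIr.
rewrite !toW; apply: subset_trans (wgenI 0 _ _ comm ip (leqnn r)) _.
apply: wgenS => k _ kr /= /andP[/existsP[i /andP[iJ /eqP ik]] /existsP[l /andP[lK /eqP lk]]].
rewrite kr /=; apply/existsP; exists i; rewrite ik eqxx andbT inE iJ.
by have -> : i = l by apply: val_inj; rewrite /= ik lk.
Qed.

(** [s] inverts [s * t], hence normalises the rotation subgroup, and every element is a rotation
    times a power of [s]. *)
Lemma gen2_involutions (s t : gT) : s * s = 1 -> t * t = 1 ->
  <<[set s; t]>> \subset <[s * t]> :|: <[s * t]> :* s.
Proof.
move=> s2 t2.
have sV : s^-1 = s by apply: (mulgI s); rewrite mulgV s2.
have tV : t^-1 = t by apply: (mulgI t); rewrite mulgV t2.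
have nS : <[s]> \subset 'N(<[s * t]>).
  rewrite cycle_subG; apply/normP; rewrite -cycleJ conjgE sV !mulgA s2 mul1g.
  by rewrite -(cycleV (s * t)) invMg sV tV.
have sub : <<[set s; t]>> \subset <[s * t]> * <[s]>.
  rewrite -(norm_joinEr nS).
  have hs : s \in <[s * t]> <*> <[s]>.
    by apply: (subsetP (joing_subr _ _)); apply: cycle_id.
  have hst : s * t \in <[s * t]> <*> <[s]>.
    by apply: (subsetP (joing_subl _ _)); apply: cycle_id.
  rewrite gen_subG; apply/subsetP=> x /set2P[->|->] //.
  by have := groupM hs hst; rewrite mulgA s2 mul1g.
apply: subset_trans sub _; apply/subsetP=> _ /mulsgP[x y xH /cycleP[k ->] ->].
rewrite !inE -(odd_double_half k) expgD -mul2n expgM.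
rewrite (s2 : s ^+ 2 = 1).
rewrite expg1n mulg1; case: (odd k); last by rewrite mulg1 xH.
by rewrite expg1 mem_rcoset mulgK xH orbT.
Qed.

(** * Rank reduction *)

Definition contract rho i : gT :=
  match i with 0%N => rho 1%N | 1%N => rho 0 * rho 2 | _ => rho i.+1 end.

(** Otherwise the generators up to [k] centralise the later ones, and the group is the product of
    two nontrivial normal subgroups with trivial intersection. *)
Lemma simple_stringC_neq_commute rho r k : stringC rho r -> simple (itv rho 0 r) ->
  k.+1 < r -> 2 < r -> ~ commute (rho k) (rho k.+1).
Proof.
case=> inv comm ip simG kr r2 ckk.
have cAB : itv rho 0 k.+1 \subset 'C(itv rho k.+1 r).
  apply: itv_sub => i _ ik; rewrite -sub_cent1; apply: itv_sub => j kj jr.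
  apply/cent1P.
  have [->|ni] := eqVneq i k; last by apply/commute_sym/comm; lia.
  have [->|nj] := eqVneq j k.+1; first exact: commute_sym.
  by apply/commute_sym/comm; lia.
have GE : itv rho 0 r = itv rho 0 k.+1 * itv rho k.+1 r.
  rewrite -(cent_joinEl cAB); apply/eqP; rewrite eqEsubset join_subG !itvS ?andbT //; try lia.
  apply: itv_sub => i _ ir; have [ik|ki] := ltnP i k.+1.
    by rewrite (subsetP (joing_subl _ _)) // mem_itv.
  by rewrite (subsetP (joing_subr _ _)) // mem_itv.
have tI : itv rho 0 k.+1 :&: itv rho k.+1 r = 1.
  apply/trivgP; rewrite -(itv_nil rho (leqnn k.+1)).
  by apply: (itvI ip) => //; lia.
have nA : itv rho 0 k.+1 <| itv rho 0 r.
  rewrite /normal itvS ?(ltnW kr) //= GE mulG_subG normG.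
  by rewrite (subset_trans _ (cent_sub _)) // centsC.
case/simpleP: simG => _ /(_ _ nA)[A1|AG].
  have: rho k \in itv rho 0 k.+1 by apply: mem_itv.
  by rewrite A1 => /set1P r1; have [] := inv k (ltnW kr); rewrite r1 eqxx.
have: rho k.+1 \in itv rho 0 k.+1 :&: itv rho k.+1 r.
  by rewrite inE AG !mem_itv.
by rewrite tI => /set1P r1; have [] := inv k.+1 kr; rewrite r1 eqxx.
Qed.
End StringC.

Section Contract.
Variable gT : finGroupType.
Implicit Types (rho : nat -> gT).

Lemma involution_invg (s : gT) : s * s = 1 -> s^-1 = s.
Proof. by move=> s2; apply: (mulgI s); rewrite mulgV s2. Qed.

(** Conjugation by [s] inverts every rotation, and [z] is its own inverse. *)
Lemma rotation_involution_commute (s t z : gT) : s * s = 1 -> t * t = 1 ->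
  z * z = 1 -> z \in <[s * t]> -> commute z s.
Proof.
move=> s2 t2 z2 /cycleP[k zE]; apply/commgP/conjg_fixP.
have [[sV tV] zV] := (involution_invg s2, involution_invg t2, involution_invg z2).
rewrite -{2}zV zE conjXg conjgE sV !mulgA s2 mul1g -expgVn invMg sV tV.
by [].
Qed.

(** Either [u] or [u * t] is a rotation, and both square to 1. It is applied with [u] and [u * t]
    equal to [rho 0] and [rho 2], neither of which commutes with [rho 1]. *)
Lemma dihedral_commute (s t u : gT) : s * s = 1 -> t * t = 1 -> u * u = 1 ->
  (u * t) * (u * t) = 1 -> u \in <<[set s; t]>> -> commute u s \/ commute (u * t) s.
Proof.
move=> s2 t2 u2 ut2 /(subsetP (gen2_involutions s2 t2)); rewrite inE => /orP[uH|].
  by left; apply: (rotation_involution_commute s2 t2).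
rewrite mem_rcoset (involution_invg s2) => usH; right.
apply: (rotation_involution_commute s2 t2) => //.
have -> : u * t = (u * s) * (s * t) by rewrite mulgA -(mulgA u s) s2 mulg1.
by rewrite groupM ?cycle_id.
Qed.

Lemma contractP rho r : 2 < r -> stringC rho r.+1 -> simple (itv rho 0 r.+1) ->
  odd #[rho 2 * rho 3] ->
  stringC (contract rho) r /\ itv (contract rho) 0 r = itv rho 0 r.+1.
Proof.
move=> r3 SC simG odd23; have [inv comm ip] := SC.
have i2 k : k < r.+1 -> rho k * rho k = 1 by move=> /inv[].
have c02 : commute (rho 0) (rho 2) by apply: comm; lia.
have c03 : commute (rho 0) (rho 3) by apply: comm; lia.
have t2 : (rho 0 * rho 2) * (rho 0 * rho 2) = 1.
  by rewrite mulgA -(mulgA (rho 0)) -c02 mulgA i2 ?mul1g ?i2 //; lia.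
have wI J K x : x \in wgen rho 0 r.+1 J -> x \in wgen rho 0 r.+1 K ->
    x \in wgen rho 0 r.+1 [pred k | J k && K k].
  by move=> xJ xK; apply: (subsetP (wgenI 0 J K comm ip (leqnn _))); rewrite inE xJ.
pose s := contract rho.
have W1 i j : 1 < i -> itv s i j = itv rho i.+1 j.+1.
  move=> i1; apply/eqP; rewrite eqEsubset; apply/andP; split; apply: itv_sub => k ik kj.
    case: k ik kj => [|[|k]] ik kj; try lia.
    by apply: (@mem_itv _ rho i.+1 j.+1 k.+3); lia.
  case: k ik kj => [|[|[|k]]] ik kj; try lia.
  by apply: (@mem_itv _ s i j k.+2); lia.
have r0s j : 2 < j -> rho 0 \in itv s 1 j.
  (* [rho 0] commutes with [rho 2 * rho 3]; the odd order of the latter, used as exponent, kills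
     that factor and keeps the involution [rho 0]. *)
  move=> j3; have -> : rho 0 = ((rho 0 * rho 2) * rho 3) ^+ #[rho 2 * rho 3].
    rewrite -mulgA expgMn; last by apply: commuteM.
    rewrite expg_order mulg1 -(odd_double_half #[_]) odd23 expgS -mul2n expgM.
    by rewrite (i2 0%N (ltn0Sn _) : rho 0 ^+ 2 = 1) expg1n mulg1.
  by apply/groupX/groupM; [apply: (@mem_itv _ s 1 j 1) | apply: (@mem_itv _ s 1 j 2)]; lia.
have r2s j : 2 < j -> rho 2 \in itv s 1 j.
  move=> j3; have -> : rho 2 = rho 0 * (rho 0 * rho 2) by rewrite mulgA i2 ?mul1g.
  by rewrite groupM ?r0s //; apply: (@mem_itv _ s 1 j 1); lia.
(* With at least two of them, the generators of [s] after the first generate a subgroup of [rho]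
   that merely omits [rho 1], so the intersection property of [rho] applies. *)
have W2 j : 2 < j -> wgen rho 0 j.+1 (predC1 1%N) \subset itv s 1 j.
  move=> j3; apply: wgen_sub => k _ kj.
  case: k kj => [|[|[|k]]] kj //= _; rewrite ?r0s ?r2s //.
  by apply: (@mem_itv _ s 1 j k.+2); lia.
have W2' j : j <= r -> itv s 1 j \subset wgen rho 0 r.+1 [pred k | (k < j.+1) && (k != 1%N)].
  move=> jr; apply: itv_sub => k k1 kj; case: k k1 kj => [|[|k]] // k1 kj.
    by rewrite /s /= groupM // mem_wgen //=; lia.
  by rewrite /s /= mem_wgen //=; lia.
have W3' j : 1 < j -> j <= r -> itv s 0 j \subset wgen rho 0 r.+1 [pred k | k < j.+1].
  move=> j1 jr; apply: itv_sub => k _ kj; case: k kj => [|[|k]] kj.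
  - by rewrite /s /= mem_wgen //=; lia.
  - by rewrite /s /= groupM // mem_wgen //=; lia.
  - by rewrite /s /= mem_wgen //=; lia.
have W0 : itv s 0 r = itv rho 0 r.+1.
  apply/eqP; rewrite eqEsubset; apply/andP; split; apply: itv_sub => k _ kr.
    case: k kr => [|[|k]] kr; first by apply: mem_itv; lia.
      by rewrite groupM ?mem_itv //; lia.
    by apply: (@mem_itv _ rho 0 r.+1 k.+3); lia.
  case: k kr => [|[|k]] kr.
  - by apply: (subsetP (itvS _ _ _)) (r0s r r3).
  - by apply: (@mem_itv _ s 0 r 0); lia.
  have [->|nk] := eqVneq k 0%N; first by apply: (subsetP (itvS _ _ _)) (r2s r r3).
  by case: k kr nk => // k kr _; apply: (@mem_itv _ s 0 r k.+2); lia.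
have ncomm k : k < r -> ~ commute (rho k) (rho k.+1).
  by move=> kr; apply: (simple_stringC_neq_commute SC simG); lia.
have r0D : rho 0 \notin <<[set rho 1%N; rho 0 * rho 2]>>.
  have E2 : rho 0 * (rho 0 * rho 2) = rho 2 by rewrite mulgA i2 ?mul1g.
  apply/negP=> h; have := @dihedral_commute (rho 1%N) (rho 0 * rho 2) (rho 0).
  rewrite !E2 !i2 //; try lia.
  case=> // [c|/commute_sym c]; first by apply: (ncomm 0%N) => //; lia.
  by apply: (ncomm 1%N) c; lia.
split=> //; split.
- move=> [|[|k]] kr /=.
  + by split; [have [] := inv 1%N|apply: i2]; lia.
  + split=> //; apply/eqP=> r02; have /inv[/negP n2 _] : 2 < r.+1 by lia.
    apply: n2.
    suff: rho 2 \in itv rho 0 1 :&: itv rho 1 3.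
      have : itv rho 0 1 :&: itv rho 1 3 \subset itv rho 1 1.
        by apply: (itvI ip) => //; lia.
      by move=> /subsetP h /h; rewrite itv_nil // => /set1P->.
    rewrite inE (@mem_itv _ rho 1 3 2) // andbT.
    have -> : rho 2 = rho 0 by apply: (mulgI (rho 0)); rewrite r02 i2.
    exact: mem_itv.
  + by have [n1 _] := inv k.+3 kr; split=> //; apply: i2.
- move=> i j ij jr; case: i ij => [|[|i]] ij; case: j ij jr => [|[|j]] ij jr //=; try lia.
  + by apply: comm; lia.
  + by apply/commute_sym/commuteM; apply/commute_sym/comm; lia.
  + by apply: comm; lia.
move=> i j ij jr; case: i ij => [|[|i]] ij.
- case: j ij jr => [|[|[|[|j]]]] // _ jr; apply/subsetP=> x /setIP[x1 x2].
  + suff: x \in wgen rho 0 r.+1 [pred k | (k == 1%N) && ((k < 3) && (k != 1%N))].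
      move=> /(subsetP (wgen_sub (H := 1%G) _)) /= h; rewrite (set1P (h _)) ?group1 //.
      by move=> k _ _ /= /and3P[/eqP->].
    apply: (wI (pred1 1%N)); last by apply: (subsetP (W2' 2 _)).
    apply: (subsetP (itv_sub _)) x1 => -[|k] // _ _.
    by rewrite /s /= mem_wgen //=; lia.
  (* The delicate window: [x] lies in the Klein group of [rho 0] and [rho 2], and if it were not a
     power of [rho 0 * rho 2], then [rho 0] would lie in the dihedral group excluded by [r0D]. *)
  + have : x \in wgen rho 0 r.+1 [pred k | (k < 3) && ((k < 4) && (k != 1%N))].
      by apply: wI; [apply: (subsetP (W3' 2 isT (ltnW r3))) | apply: (subsetP (W2' 3 r3))].
    have xD : x \in <<[set rho 1%N; rho 0 * rho 2]>>.
      apply: (subsetP (itv_sub _)) x1 => -[|[|k]] // _ _; rewrite mem_gen // !inE eqxx ?orbT //.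
    have tD : rho 0 * rho 2 \in <<[set rho 1%N; rho 0 * rho 2]>>.
      by rewrite mem_gen // !inE eqxx orbT.
    have sub : wgen rho 0 r.+1 [pred k | (k < 3) && ((k < 4) && (k != 1%N))]
        \subset <<[set rho 0; rho 2]>>.
      apply: wgen_sub => -[|[|[|k]]] _ _ //= _; rewrite mem_gen // !inE eqxx ?orbT //.
    move=> /(subsetP sub) /(subsetP (gen2_involutions (i2 0%N isT) (i2 2 (ltnW r3)))).
    rewrite inE mem_rcoset.
    have tt : rho 0 * rho 2 \in itv s 1 2 by apply: (@mem_itv _ s 1 2 1).
    case/orP=> [/cycleP[k ->]|/cycleP[k xE]]; first by rewrite groupX.
    case/negP: r0D; rewrite -groupV.
    have -> : (rho 0)^-1 = x^-1 * (rho 0 * rho 2) ^+ k by rewrite -xE mulKg.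
    by rewrite groupM ?groupV ?groupX.
  + apply: (subsetP (W2 j.+3 _)) => //.
    have : x \in wgen rho 0 r.+1 [pred k | (k < j.+4) && ((k < j.+4.+1) && (k != 1%N))].
      apply: wI; first by apply: (subsetP (W3' j.+3 _ _)) => //; lia.
      exact: (subsetP (W2' j.+4 _)).
    by apply: (subsetP (wgenS _ _)) => k _ kr /=; lia.
- apply/subsetP=> x /setIP[x1 x2]; rewrite W1 //.
  have : x \in wgen rho 0 r.+1 [pred k | ((k < j.-1.+1) && (k != 1%N)) && (2 < k)].
    apply: wI; first by apply: (subsetP (W2' j.-1 _)) => //; lia.
    move: x2; rewrite W1 //; apply: (subsetP (itv_sub _)) => k k3 kj.
    by rewrite mem_wgen //=; lia.
  by apply: (subsetP (wgenS _ _)) => k _ kr /=; lia.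
rewrite !W1 // prednK; last lia.
by apply: (ip i.+3 j.+1); lia.
Qed.

End Contract.

(** Each contraction shifts the later generators down by one, so round [i] uses the odd order of
    [rho i.+2 * rho i.+3]. *)
Lemma contract_iter (gT : finGroupType) (rho : nat -> gT) r m :
    stringC rho r -> simple (itv rho 0 r) -> m.+3 <= r ->
    (forall i, i < m -> odd #[rho i.+2 * rho i.+3]) ->
  exists2 s : nat -> gT, stringC s (r - m) & itv s 0 (r - m) = itv rho 0 r.
Proof.
elim: m rho r => [|m IH] rho r SC simG mr hodd; first by exists rho; rewrite ?subn0.
case: r SC simG mr => // r SC simG mr.
have r3 : 2 < r by rewrite -ltnS (leq_trans _ mr).
have [SC' G'] := contractP r3 SC simG (hodd 0%N isT).
have [||i im|s SCs Gs] := IH (contract rho) r SC'; rewrite ?G' //.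
  exact: hodd i.+1 im.
by exists s; rewrite subSS // Gs G'.
Qed.

(** * Permutations and 3-cycles *)

Section PermLemmas.
Variable T : finType.
Implicit Types (s t : {perm T}) (x y z : T) (A : {set T}) (G : {group {perm T}}).

Lemma involution_perm s x : s * s = 1 -> s (s x) = x.
Proof. by move=> s2; rewrite -permM s2 perm1. Qed.

(** Splitting off the transposition of [x] and [s x] removes exactly two moved points. *)
Lemma odd_involution s : s * s = 1 -> odd_perm s = odd (#|[set x | s x != x]|./2).
Proof.
have [d] := ubnP #|[set x | s x != x]|; elim: d s => // d IH s sd s2.
have [x|s1] := pickP [pred x | s x != x]; last first.
  have -> : s = 1 by apply/permP=> x; rewrite perm1; apply/eqP/negbFE/s1.
  rewrite odd_perm1 (_ : [set x | _] = set0) ?cards0 //.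
  by apply/setP=> x; rewrite !inE perm1 eqxx.
rewrite /= => sx; pose t := tperm x (s x) * s.
have ss := involution_perm _ s2.
have tE z : t z = if (z == x) || (z == s x) then z else s z.
  rewrite permM; have [->|zx] := eqVneq z x; first by rewrite tpermL ss.
  have [->|zsx] /= := eqVneq z (s x); first by rewrite tpermR.
  by rewrite tpermD // eq_sym.
have t2 : t * t = 1.
  apply/permP=> z; rewrite permM perm1 [t z]tE; case: ifP => [zx|/norP[zx zsx]].
    by rewrite tE zx.
  rewrite tE (inj_eq perm_inj) -{1}[x]ss (inj_eq perm_inj).
  by rewrite (negPf zx) (negPf zsx) ss.
have mE : [set z | s z != z] = x |: (s x |: [set z | t z != z]).
  apply/setP=> z; rewrite !inE tE; have [->|zx] := eqVneq z x; first by rewrite sx.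
  have [->|zsx] //= := eqVneq z (s x); by rewrite ss eq_sym sx.
have cE : #|[set z | s z != z]| = #|[set z | t z != z]|.+2.
  rewrite mE !cardsU1 !inE !tE !eqxx ?orbT /= orbF eq_sym sx.
  by rewrite eqxx.

have sE : s = tperm x (s x) * t by rewrite mulgA tperm2 mul1g.
rewrite cE /= [in LHS]sE odd_mul_tperm eq_sym sx IH //.
by move: sd; rewrite cE; lia.
Qed.

Lemma odd_involution_imset (I : finType) (f g : I -> T) s : s * s = 1 ->
    injective f -> injective g -> (forall i j, f i != g j) ->
    (forall i, s (f i) = g i) ->
    (forall x, s x != x -> x \in codom f \/ x \in codom g) ->
  odd_perm s = odd #|I|.
Proof.
move=> s2 fI gI fg sf mv; rewrite odd_involution //.
have sg i : s (g i) = f i by rewrite -sf involution_perm.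
have -> : [set x | s x != x] = f @: I :|: g @: I.
  apply/setP=> x; rewrite !inE; apply/idP/orP=> [/mv[]/codomP[i ->]|[]/imsetP[i _ ->]].
  - by left; apply: imset_f.
  - by right; apply: imset_f.
  - by rewrite sf eq_sym.
  - by rewrite sg.
rewrite cardsU !card_imset // (_ : _ :&: _ = set0) ?cards0 ?subn0 ?addnn ?doubleK //.
apply/setP=> x; rewrite !inE; apply/negbTE/andP=> -[/imsetP[i _ ->] /imsetP[j _ /eqP]].
by rewrite (negPf (fg i j)).
Qed.

(** Products of permutations apply the left factor first, so for distinct points this sends [x] to
    [y], [y] to [z] and [z] to [x]. *)
Definition c3 x y z := tperm x y * tperm x z.

Lemma c3J x y z s : c3 x y z ^ s = c3 (s x) (s y) (s z).
Proof. by rewrite conjMg !tpermJ. Qed.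

Lemma c3V x y z : (c3 x y z)^-1 = c3 x z y.
Proof. by rewrite invMg !tpermV. Qed.

Lemma c3_rot x y z : x != y -> y != z -> x != z -> c3 x y z = c3 y z x.
Proof.
move=> xy yz xz; rewrite /c3 (tpermC y x).
have -> : tperm x y * tperm x z = tperm x z ^ tperm x y * tperm x y.
  by rewrite conjgE tpermV -!mulgA tperm2 mulg1.
by rewrite tpermJ tpermL tpermD.
Qed.
End PermLemmas.

(** * Extension of permutations along an injection *)

Section Push.
Variables (Y X : finType) (h : Y -> X).
Hypothesis h_inj : injective h.
Implicit Types (s t : {perm Y}).

Definition push_fun s x := if [pick y | h y == x] is Some y then h (s y) else x.

Lemma push_funE s y : push_fun s (h y) = h (s y).
Proof.
rewrite /push_fun; case: pickP => [z /eqP/h_inj -> //|/(_ y)].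
by rewrite eqxx.
Qed.

Lemma push_fun_out s x : x \notin codom h -> push_fun s x = x.
Proof.
move=> xh; rewrite /push_fun; case: pickP => // y /eqP hy.
by rewrite -hy codom_f in xh.
Qed.

Lemma push_funK s : cancel (push_fun s) (push_fun s^-1).
Proof.
move=> x; have [/codomP[y ->]|xh] := boolP (x \in codom h).
  by rewrite !push_funE permK.
by rewrite !push_fun_out.
Qed.

Definition push s : {perm X} := perm (can_inj (push_funK s)).

Lemma pushE s y : push s (h y) = h (s y).
Proof. by rewrite permE push_funE. Qed.

Lemma push_out s x : x \notin codom h -> push s x = x.
Proof. by move=> xh; rewrite permE push_fun_out. Qed.

Lemma pushM : {morph push : s t / s * t}.
Proof.
move=> s t; apply/permP=> x; rewrite permM.
have [/codomP[y ->]|xh] := boolP (x \in codom h); first by rewrite !pushE permM.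
by rewrite !push_out.
Qed.

Canonical push_morphism := Morphism (in2W pushM : {in setT &, {morph push : s t / s * t}}).

Lemma push_inj : injective push.
Proof.
by move=> s t st; apply/permP=> y; apply: h_inj; rewrite -!pushE st.
Qed.

Lemma push_injm : 'injm push_morphism.
Proof. by apply/injmP=> s t _ _; apply: push_inj. Qed.

Lemma push_tperm y z : push (tperm y z) = tperm (h y) (h z).
Proof.
apply/permP=> x; have [/codomP[w ->]|xh] := boolP (x \in codom h).
  by rewrite pushE inj_tperm.
by rewrite push_out // tpermD //; apply: contraNneq xh => <-; apply: codom_f.
Qed.

Lemma odd_push s : odd_perm (push s) = odd_perm s.
Proof.
have [ts -> dts] := prod_tpermP s.
rewrite (big_morph push pushM (morph1 push_morphism)).
under eq_bigr do rewrite push_tperm.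
rewrite -[in LHS](big_map (fun p : Y * Y => (h p.1, h p.2)) predT (fun p => tperm p.1 p.2)).
by rewrite !odd_perm_prod ?size_map // all_map; apply: sub_all dts => p; rewrite /= (inj_eq h_inj).
Qed.

End Push.

(** * Jordan's argument: from 3-cycles to all even permutations *)

Section Jordan.
Variables (T : finType) (G : {group {perm T}}).
Implicit Types (x y z : T).

(* Jordan's relation: an equivalence such that [G] contains every 3-cycle inside a class. *)
Definition c3_rel x y := (x == y) || [exists z, [&& x != y, y != z, x != z & c3 x y z \in G]].

Lemma c3_relP x y : reflect (x = y \/ exists z, [/\ x != y, y != z, x != z & c3 x y z \in G]) (c3_rel x y).
Proof.
apply: (iffP orP) => -[/eqP|]; first by left.
- by case/existsP=> z /and4P[? ? ? ?]; right; exists z.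
- by left.
- by case=> z [xy yz xz cG]; right; apply/existsP; exists z; rewrite xy yz xz.
Qed.

Lemma c3_rel_mem x y z : x != y -> y != z -> x != z -> c3 x y z \in G ->
  [/\ c3_rel x y, c3_rel y z & c3_rel x z].
Proof.
move=> xy yz xz cG; split; apply/c3_relP; right.
- by exists z.
- by exists x; rewrite -c3_rot // (eq_sym z) (eq_sym y x).
by exists y; rewrite -c3V groupV (eq_sym z).
Qed.

Lemma c3_rel_sym x y : c3_rel x y -> c3_rel y x.
Proof.
case/c3_relP=> [->|[z [xy yz xz cG]]]; first exact/c3_relP/or_introl.
have yx : y != x by rewrite eq_sym.
have cG' : c3 y x z \in G by rewrite -groupV c3V -c3_rot.
by have [] := c3_rel_mem yx xz yz cG'.
Qed.

Lemma c3_rel_perm x y g : g \in G -> c3_rel x y -> c3_rel (g x) (g y).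
Proof.
move=> gG /c3_relP[->|[z [xy yz xz cG]]]; apply/c3_relP; [by left|right].
by exists (g z); rewrite !(inj_eq perm_inj) -c3J groupJ.
Qed.

Lemma c3E x y z w : x != y -> y != z -> x != z ->
  c3 x y z w = if w == x then y else if w == y then z else if w == z then x else w.
Proof.
move=> xy yz xz; rewrite permM; have [->|wx] := eqVneq w x.
  by rewrite tpermL tpermD // eq_sym.
have [->|wy] := eqVneq w y; first by rewrite tpermR tpermL.
have -> : tperm x y w = w by rewrite tpermD // eq_sym.
have [->|wz] := eqVneq w z; first by rewrite tpermR.
by rewrite tpermD // eq_sym.
Qed.

(** The inverse of the 3-cycle on [x], [y], [z] moves [y] to [x] and fixes any [w] outside these
    three points, so it carries the second relation to the desired one. *)
Lemma c3_rel_trans x y w : c3_rel x y -> c3_rel y w -> c3_rel x w.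
Proof.
case/c3_relP=> [->//|[z [xy yz xz cG]]] yw.
have [xy' yz' xz'] := c3_rel_mem xy yz xz cG.
have [->//|wy] := eqVneq w y; have [->//|wz] := eqVneq w z.
have [->|wx] := eqVneq w x; first exact/c3_relP/or_introl.
have := c3_rel_perm (groupVr cG) yw.
have -> : (c3 x y z)^-1 y = x by apply: (canLR (permK _)); rewrite c3E // eqxx.
suff -> : (c3 x y z)^-1 w = w by [].
by apply: (canLR (permK _)); rewrite c3E // (negPf wx) (negPf wy) (negPf wz).
Qed.

(** There are 3-cycles (x y w) and (w z u) in [G]. Conjugating the first by the second replaces [w]
    by [z]; when [u] is [x] or [y], the inverse of the second does the job up to inversion. *)
Lemma c3_rel_c3 x y z : x != y -> y != z -> x != z ->
  c3_rel x y -> c3_rel y z -> c3 x y z \in G.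
Proof.
move=> xy yz xz /c3_relP[/eqP|]; first by rewrite (negPf xy).
case=> w [_ yw xw cG] ryz.
have [->//|zw] := eqVneq z w.
have : c3_rel w z.
  apply: c3_rel_trans ryz; apply: c3_rel_sym.
  by have [] := c3_rel_mem xy yw xw cG.
case/c3_relP=> [/esym/eqP|]; first by rewrite (negPf zw).
case=> u [wz zu wu dG].
have wx : w != x by rewrite eq_sym.
have wy : w != y by rewrite eq_sym.
have zx : z != x by rewrite eq_sym.
have zy : z != y by rewrite eq_sym.
have yx : y != x by rewrite eq_sym.
have [ux|ux] := eqVneq u x; [|have [uy|uy] := eqVneq u y].
- have dG' : c3 w x z \in G by rewrite -groupV c3V -ux.
  have := groupJ cG dG'; rewrite c3J !c3E // !eqxx.
  rewrite (negPf xw) (negPf yw) (negPf yx) (negPf yz) => zyx.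
  by rewrite c3_rot // -groupV c3V -c3_rot.
- have dG' : c3 w y z \in G by rewrite -groupV c3V -uy.
  have := groupJ cG dG'; rewrite c3J !c3E // !eqxx.
  rewrite (negPf xw) (negPf xy) (negPf xz) (negPf yw) => xzy.
  by rewrite -groupV c3V.
have := groupJ cG dG; rewrite c3J !c3E // !eqxx.
by rewrite (negPf xw) (negPf yw) (negPf xz) (negPf yz) !(eq_sym _ u) (negPf ux) (negPf uy).
Qed.

(** Induction on the number of moved points. If [s] moves [a] to [b] and moves a third point [c],
    then multiplying by a 3-cycle fixes [a] and moves no new point; without a third point [s] would
    be an odd transposition. *)
Lemma even_on_c3 (A : {set T}) s :
  (forall x y z, x \in A -> y \in A -> z \in A -> x != y -> y != z -> x != z -> c3 x y z \in G) ->
  perm_on A s -> ~~ odd_perm s -> s \in G.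
Proof.
move=> AG; have [d] := ubnP #|[set x | s x != x]|; elim: d s => // d IH s sd sA s_even.
have [a|s1] := pickP [pred x | s x != x]; last first.
  have -> : s = 1 by apply/permP=> x; rewrite perm1; apply/eqP/negbFE/s1.
  exact: group1.
move=> /= sa; set b := s a in sa.
have mA x : s x != x -> x \in A by apply: (subsetP sA).
have sb : s b != b by rewrite (inj_eq perm_inj).
have [c /and3P[/= sc ca cb]|nc] := pickP [pred c | [&& s c != c, c != a & c != b]]; last first.
  suff sE : s = tperm a b by rewrite sE odd_tperm eq_sym sa in s_even.
  have fx c : c != a -> c != b -> s c = c.
    by move=> ca cb; apply/eqP; have /negbT := nc c; rewrite /= ca cb !andbT negbK.
  apply/permP=> c; case: tpermP => [->//|->|/eqP ca /eqP cb]; last exact: fx.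
  apply/eqP; apply: contraT => sba; have := fx (s b) sba sb.
  by move/perm_inj/eqP; rewrite (negPf sb).
have aA := mA a sa; have bA := mA b sb; have cA := mA c sc.
have ba : b != a by []; have bc : b != c by rewrite eq_sym. have ac : a != c by rewrite eq_sym.
have cG : c3 b a c \in G by apply: AG.
have sE : s = (s * c3 b a c) * (c3 b a c)^-1 by rewrite mulgK.
rewrite sE groupM ?groupV //.
have eE x : (s * c3 b a c) x = if s x == b then a else if s x == a then c else if s x == c then b else s x.
  by rewrite permM c3E.
apply: IH.
- rewrite ltnS in sd; apply: leq_trans sd.
  apply: proper_card; apply/properP; split; last first.
    by exists a; rewrite !inE // eE eqxx eqxx.
  apply/subsetP=> x; rewrite !inE; apply: contraNN => /eqP sx; rewrite eE sx.
  have xb : x != b by apply: contraNneq sb => <-; rewrite sx.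
  have xa : x != a by apply: contraNneq sa => xa; rewrite /b -xa sx.
  have xc : x != c by apply: contraNneq sc => <-; rewrite sx.
  by rewrite (negPf xb) (negPf xa) (negPf xc).
- apply: perm_onM => //; apply/subsetP=> x; rewrite inE c3E //.
  have [->//|_] := eqVneq x b; have [->//|_] := eqVneq x a.
  by have [->//|_] := eqVneq x c; rewrite eqxx.
by rewrite odd_permM (negPf s_even) odd_permM !odd_tperm ba bc.
Qed.

End Jordan.

(** * Gluing two string C-groups at a point *)

Section Orb.
Variable X : finType.
Implicit Types (H : {group {perm X}}) (S : {set X}) (x s : {perm X}).

Definition orb (H : {set {perm X}}) (v : X) : {set X} := [set s v | s : {perm X} in H].

Lemma orbP (H : {set {perm X}}) v y : reflect (exists2 s : {perm X}, s \in H & y = s v) (y \in orb H v).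
Proof. exact: imsetP. Qed.

Lemma orb_refl H v : v \in orb H v.
Proof. by apply/orbP; exists 1; rewrite ?group1 ?perm1. Qed.

Lemma orb_stable H v y s : s \in H -> y \in orb H v -> s y \in orb H v.
Proof.
by move=> sH /orbP[t tH ->]; apply/orbP; exists (t * s); rewrite ?groupM ?permM.
Qed.

Lemma orb1 v : orb 1 v = [set v].
Proof.
apply/setP=> y; rewrite inE; apply/orbP/eqP=> [[s /set1P-> ->]|->].
  by rewrite perm1.
by exists 1; rewrite ?group1 ?perm1.
Qed.

Lemma perm_onS S S' x : S \subset S' -> perm_on S x -> perm_on S' x.
Proof. by move=> h1 h2; apply: subset_trans h1. Qed.

Lemma perm_onI S S' x : perm_on S x -> perm_on S' x -> perm_on (S :&: S') x.
Proof.
by move=> /subsetP h1 /subsetP h2; apply/subsetP=> y hy; rewrite inE h1 ?h2.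
Qed.

Lemma perm_onJ S s x : (forall y, y \in S -> s y \in S) -> perm_on S x -> perm_on S (x ^ s).
Proof.
move=> sS /subsetP xS; apply/subsetP=> y; rewrite inE -(permKV s y) permJ.
by rewrite (inj_eq perm_inj) => h; apply/sS/xS.
Qed.

Lemma conj_perm_on S x s (t : {perm X}) : perm_on S x -> {in S, s =1 t} -> x ^ s = x ^ t.
Proof.
move=> xS st; apply/permP=> y; rewrite -(permKV s y); move: (s^-1 y) => z.
have [zS|zS] := boolP (z \in S).
  by rewrite permJ (st _ zS) permJ st // perm_closed.
rewrite permJ (out_perm xS zS) -(permKV t (s z)) permJ (out_perm xS) //.
by apply: contra zS => h; have := st _ h; rewrite permKV => /perm_inj <-.
Qed.

Lemma perm_on_fix S x v : perm_on S x -> x v = v -> perm_on (S :\ v) x.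
Proof.
move=> /subsetP xS xv; apply/subsetP=> y xy; rewrite !inE xS // andbT.
by apply: contraNneq xy => ->; rewrite xv.
Qed.

Definition Symon S : {group {perm X}} := [group of perm.Sym S].
Lemma SymonE S x : (x \in Symon S) = perm_on S x.
Proof. by rewrite inE. Qed.
End Orb.

Record piece (X : finType) (A : {set X}) (v : X) (s : nat) (q : nat -> {perm X}) : Prop := Piece {
  piece_gt0 : 0 < s;
  piece_str : stringC q s;
  piece_on : forall i, i < s -> perm_on A (q i);
  piece_even : forall i, i < s -> ~~ odd_perm (q i);
  piece_fix : forall i, 0 < i -> i < s -> q i v = v;
  piece_star : forall j x, 0 < j -> j < s -> x \in itv q 0 j.+1 ->
    perm_on (orb (itv q 0 j) v) x -> x \in itv q 0 j;
  piece_tr : forall y, y \in A -> y \in orb (itv q 0 s) v }.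

Section Glue.
Variables (X : finType) (A B : {set X}) (v : X) (k s : nat) (t q : nat -> {perm X}).
Hypotheses (tP : piece A v k t) (qP : piece B v s q).
Hypotheses (AB : A :&: B = [set v]) (ABT : A :|: B = setT).

Definition glue i := if i < k then t (k.-1 - i) else q (i - k).

Let T a := itv t 0 a.
Let R b := itv q 0 b.
Let OT a := orb (T a) v.
Let OQ b := orb (R b) v.
Let U a b := OT a :|: OQ b.
Let G a b := T a <*> R b.

(** If [p 0] fixed [v], the whole group would; by transitivity [C] would be a single point and [p 0]
    trivial. *)
Lemma piece_orb0 (C : {set X}) r p : piece C v r p -> p 0 v != v.
Proof.
move=> P; have r0 := piece_gt0 P; apply/eqP=> p0v.
have fx x : x \in itv p 0 r -> x v = v.
  move=> xr; have : itv p 0 r \subset 'C[v | 'P].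
    apply: itv_sub => i _ ir; apply/astab1P; rewrite /= apermE.
    by case: i ir => [|i] ir //; apply: (piece_fix P).
  by move=> /subsetP/(_ _ xr)/astab1P.
have [[p1 _]] : p 0 != 1 /\ p 0 * p 0 = 1 by case: (piece_str P) => inv _ _; apply: inv.
case/eqP: p1; apply: (perm_on_id (piece_on P r0)).
rewrite -(cards1 v) subset_leq_card //; apply/subsetP=> y /(piece_tr P)/orbP[x xp ->].
by rewrite inE fx.
Qed.

Lemma glueL i j : j <= k -> itv glue i j = itv t (k - j) (k - i).
Proof.
move=> jk; apply/eqP; rewrite eqEsubset; apply/andP; split; apply: itv_sub => l h1 h2.
  by rewrite /glue ifT; [apply: mem_itv|]; lia.
have -> : t l = glue (k.-1 - l) by rewrite /glue ifT; [congr t|]; lia.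
by apply: mem_itv; lia.
Qed.

Lemma glueR i j : k <= i -> itv glue i j = itv q (i - k) (j - k).
Proof.
move=> ki; apply/eqP; rewrite eqEsubset; apply/andP; split; apply: itv_sub => l h1 h2.
  by rewrite /glue ifF; [apply: mem_itv|]; lia.
have -> : q l = glue (l + k) by rewrite /glue ifF; [congr q|]; lia.
by apply: mem_itv; lia.
Qed.

Lemma glueM i j : i <= k -> k <= j -> itv glue i j = G (k - i) (j - k).
Proof.
move=> ik kj; apply/eqP; rewrite eqEsubset join_subG; apply/andP; split.
  apply: itv_sub => l h1 h2; rewrite /glue; case: ltnP => h3.
    by apply: (subsetP (joing_subl _ _)); apply: mem_itv; lia.
  by apply: (subsetP (joing_subr _ _)); apply: mem_itv; lia.
have h1 := glueL i (leqnn k); rewrite subnn in h1.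
have h2 := glueR j (leqnn k); rewrite subnn in h2.
by rewrite /T /R -h1 -h2 !itvS.
Qed.

Lemma vAB : (v \in A) /\ (v \in B).
Proof. by apply/setIP; rewrite AB inE. Qed.

Lemma memAB y : y \in A -> y \in B -> y = v.
Proof. by move=> yA yB; apply/set1P; rewrite -AB inE yA. Qed.

Lemma T_on a x : a <= k -> x \in T a -> perm_on A x.
Proof.
move=> ak xT; rewrite -SymonE; apply: (subsetP (itv_sub _)) xT => l _ la.
by rewrite SymonE (piece_on tP) //; lia.
Qed.

Lemma R_on b x : b <= s -> x \in R b -> perm_on B x.
Proof.
move=> bs xR; rewrite -SymonE; apply: (subsetP (itv_sub _)) xR => l _ lb.
by rewrite SymonE (piece_on qP) //; lia.
Qed.

Lemma T_even a : a <= k -> T a \subset 'Alt_X.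
Proof. by move=> ak; apply: itv_sub => l _ la; rewrite Alt_even (piece_even tP) //; lia. Qed.

Lemma R_even b : b <= s -> R b \subset 'Alt_X.
Proof. by move=> bs; apply: itv_sub => l _ la; rewrite Alt_even (piece_even qP) //; lia. Qed.

Lemma OT_sub a : a <= k -> OT a \subset A.
Proof.
move=> ak; apply/subsetP=> y /orbP[x /(T_on ak) xA ->].
by rewrite perm_closed ?vAB.1.
Qed.

Lemma OQ_sub b : b <= s -> OQ b \subset B.
Proof.
move=> bs; apply/subsetP=> y /orbP[x /(R_on bs) xB ->].
by rewrite perm_closed ?vAB.2.
Qed.

Lemma T_out a x y : a <= k -> x \in T a -> y \in B -> y != v -> x y = y.
Proof.
move=> ak xT yB yv; apply: (out_perm (T_on ak xT)).
by apply: contra yv => yA; rewrite (memAB yA yB).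
Qed.

Lemma R_out b x y : b <= s -> x \in R b -> y \in A -> y != v -> x y = y.
Proof.
move=> bs xR yA yv; apply: (out_perm (R_on bs xR)).
by apply: contra yv => yB; rewrite (memAB yA yB).
Qed.

Lemma T_U a b x y : a <= k -> b <= s -> x \in T a -> y \in U a b -> x y \in U a b.
Proof.
move=> ak bs xT; rewrite !inE => /orP[yO|yO]; first by rewrite orb_stable.
have [->|yv] := eqVneq y v; first by rewrite orb_stable ?orb_refl.
by rewrite (T_out ak xT _ yv) ?yO ?orbT // (subsetP (OQ_sub bs)).
Qed.

Lemma R_U a b x y : a <= k -> b <= s -> x \in R b -> y \in U a b -> x y \in U a b.
Proof.
move=> ak bs xR; rewrite !inE => /orP[yO|yO]; last by rewrite (orb_stable xR) ?orbT.
have [->|yv] := eqVneq y v; first by rewrite (orb_stable xR) ?orb_refl ?orbT.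
by rewrite (R_out bs xR _ yv) ?yO // (subsetP (OT_sub ak)).
Qed.

(* [y^x] is [y] conjugated by the transposition [(v x(v))], as the supports of [x] and [y] meet only at [v]. *)
Lemma conj_c3 a b x y : a <= k -> b <= s -> x \in T a -> y \in R b -> x v != v ->
  y ^ x = y * c3 (x v) (y v) v.
Proof.
move=> ak bs xT yR xv.
have xvA : x v \in A by rewrite perm_closed ?(T_on ak xT) ?vAB.1.
have -> : y ^ x = y ^ tperm v (x v).
  apply: (conj_perm_on (R_on bs yR)) => z zB.
  have [->|zv] := eqVneq z v; first by rewrite tpermL.
  rewrite (T_out ak xT zB zv) tpermD // 1?eq_sym //.
  by apply: contraNneq zv => zx; apply/eqP; apply: memAB; rewrite // zx.
apply: (mulgI y^-1); rewrite mulKg conjgE tpermV.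
have -> : y^-1 * (tperm v (x v) * (y * tperm v (x v))) = tperm v (x v) ^ y * tperm v (x v).
  by rewrite conjgE !mulgA.
by rewrite tpermJ (R_out bs yR xvA xv) (tpermC (y v)) (tpermC v).
Qed.

Lemma conj_on a b x y : a <= k -> b <= s -> x \in T a -> y \in R b ->
  exists2 c, perm_on (U a b) c & y ^ x = y * c.
Proof.
move=> ak bs xT yR; have [xv|xv] := eqVneq (x v) v.
  exists 1; first exact: perm_on1.
  rewrite mulg1 (@conj_perm_on _ B y x 1) ?conjg1 ?(R_on bs yR) // => z zB; rewrite perm1.
  by have [->//|zv] := eqVneq z v; apply: (T_out ak xT).
exists (c3 (x v) (y v) v); last exact: (conj_c3 ak bs).
have vU : v \in U a b by rewrite inE orb_refl.
have xU : x v \in U a b by rewrite (T_U ak bs xT).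
have yU : y v \in U a b by rewrite (R_U ak bs yR).
have h z w : z \in U a b -> w \in U a b -> perm_on (U a b) (tperm z w).
  by move=> zU wU; apply: perm_onS (tperm_on z w); rewrite subUset !sub1set zU.
by apply: perm_onM; apply: h.
Qed.

(** By [conj_on], elements of [T a] and [R b] commute up to permutations of [U a b], a set that both
    groups preserve. This normal form is coarse, but it controls supports. *)
Lemma glue_split a b x : a <= k -> b <= s -> x \in G a b ->
  exists y z c, [/\ y \in T a, z \in R b, perm_on (U a b) c & x = y * (z * c)].
Proof.
move=> ak bs.
pose S := Symon (U a b).
have nR : R b \subset 'N(S).
  apply/subsetP=> y yR; rewrite inE; apply/subsetP=> _ /imsetP[c cS ->].
  rewrite SymonE in cS; rewrite SymonE; apply: perm_onJ cS => z; exact: (R_U ak bs yR).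
have nT : T a \subset 'N(R b <*> S).
  apply/subsetP=> y yT; rewrite inE conjYg join_subG; apply/andP; split.
    apply/subsetP=> _ /imsetP[z zR ->]; have [c cU ->] := conj_on ak bs yT zR.
    rewrite groupM //; first exact: (subsetP (joing_subl _ _)).
    by apply: (subsetP (joing_subr _ _)); rewrite SymonE.
  apply: subset_trans (joing_subr _ _); apply/subsetP=> _ /imsetP[c cS ->].
  rewrite SymonE in cS; rewrite SymonE; apply: perm_onJ cS => z; exact: (T_U ak bs yT).
have sub : G a b \subset T a <*> (R b <*> S).
  by rewrite join_subG joing_subl /= (subset_trans (joing_subl _ S)) // joing_subr.
move=> /(subsetP sub); rewrite norm_joinEl // => /mulsgP[y w yT wRS ->].
move: wRS; rewrite /= norm_joinEl // => /mulsgP[z c zR cS ->].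
by exists y, z, c; split=> //; rewrite -SymonE.
Qed.

(** Every point of either orbit is joined to [v] by a 3-cycle obtained as a commutator. The third
    point comes from the other orbit, where [t 0] or [q 0] moves [v]; hence both [a] and [b] are
    positive. *)
Lemma glue_alt a b x : 0 < a -> 0 < b -> a <= k -> b <= s ->
  perm_on (U a b) x -> ~~ odd_perm x -> x \in G a b.
Proof.
move=> a0 b0 ak bs; pose GG := (T a <*> R b)%G.
have tG : t 0 \in T a by apply: mem_itv.
have qG : q 0 \in R b by apply: mem_itv.
have tv := piece_orb0 tP; have qv := piece_orb0 qP.
have c3G y z : y \in OT a -> z \in OQ b -> y != v -> z != v ->
    [/\ y != z & c3 y z v \in GG].
  move=> /orbP[f fT ->] /orbP[g gR ->] fv gv; split.
    apply: contraNneq fv => fg; apply/eqP; apply: memAB.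
      by rewrite perm_closed ?(T_on ak fT) ?vAB.1.
    by rewrite fg perm_closed ?(R_on bs gR) ?vAB.2.
  have fG : f \in GG by apply: (subsetP (joing_subl _ _)).
  have gG : g \in GG by apply: (subsetP (joing_subr _ _)).
  by rewrite -(groupMl _ gG) -(conj_c3 ak bs) // groupJ.
have rel y : y \in U a b -> c3_rel GG v y.
  have [->|yv] := eqVneq y v; first by move=> _; apply/c3_relP; left.
  rewrite inE => /orP[yO|yO]; apply: c3_rel_sym.
    have [yq cG] := c3G y (q 0 v) yO (orb_stable qG (orb_refl _ _)) yv qv.
    by have [] := c3_rel_mem yq qv yv cG.
  have [yt cG] := c3G (t 0 v) y (orb_stable tG (orb_refl _ _)) yO tv yv.
  by have [] := c3_rel_mem yt yv tv cG.
apply: (@even_on_c3 _ GG) => y z w yU zU wU yz zw yw.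
apply: c3_rel_c3 => //; apply: c3_rel_trans (rel _ _) => //; apply: c3_rel_sym; exact: rel.
Qed.

Lemma glueP : stringC glue (k + s) /\ itv glue 0 (k + s) = 'Alt_X.
Proof.
have [k0 s0] := (piece_gt0 tP, piece_gt0 qP).
have [tinv tcomm tip] := piece_str tP; have [qinv qcomm qip] := piece_str qP.
split; last first.
  rewrite glueM ?leq_addr // subn0 addKn; apply/eqP; rewrite eqEsubset; apply/andP; split.
    by rewrite join_subG T_even ?R_even.
  apply/subsetP=> x; rewrite Alt_even => xe; apply: glue_alt => //.
  apply/subsetP=> y _; have : y \in A :|: B by rewrite ABT inE.
  by rewrite !inE => /orP[/(piece_tr tP)|/(piece_tr qP)] ->; rewrite ?orbT.
split.
- move=> i ir; rewrite /glue; case: ltnP => ik; first by apply: tinv; lia.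
  by apply: qinv; lia.
- move=> i j ij jr; rewrite /glue; case: (ltnP j k) => jk.
    by rewrite ifT; [apply/commute_sym/tcomm|]; lia.
  case: ltnP => ik; last by apply: qcomm; lia.
  have disjAB : [disjoint A :\ v & B] /\ [disjoint A & B :\ v].
    split; apply/pred0P=> y /=; apply/negbTE/negP; rewrite !inE.
      by case/andP=> /andP[yv yA] yB; rewrite (memAB yA yB) eqxx in yv.
    by case/andP=> yA /andP[yv yB]; rewrite (memAB yA yB) eqxx in yv.
  have tA : perm_on A (t (k.-1 - i)) by apply: (piece_on tP); lia.
  have qB : perm_on B (q (j - k)) by apply: (piece_on qP); lia.
  (* Only [t 0] and [q 0] move [v], and as [i.+1 < j] they are not both involved; the one fixing [v]
     has support disjoint from that of the other. *)
  have [i1|i1] := posnP (k.-1 - i).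
    apply: perm_onC tA (perm_on_fix qB _) disjAB.2.
    by apply: (piece_fix qP); lia.
  apply: perm_onC (perm_on_fix tA _) qB disjAB.1.
  by apply: (piece_fix tP); lia.
move=> i j ij jr.
have [jk|kj] := leqP j k.
  rewrite !glueL; try lia.
  have -> : k - j.-1 = (k - j).+1 by lia.
  have -> : k - i.+1 = (k - i).-1 by lia.
  by rewrite setIC; apply: tip; lia.
have [ki|ik] := leqP k i.
  rewrite !glueR ?(leqW ki) //.
  have -> : j.-1 - k = (j - k).-1 by lia.
  have -> : i.+1 - k = (i - k).+1 by lia.
  by apply: qip; lia.
rewrite !glueM; try lia.
have -> : j.-1 - k = (j - k).-1 by lia.
have -> : k - i.+1 = (k - i).-1 by lia.
have [a ak a0] : exists2 a, a <= k & k - i = a.+1 by exists (k - i).-1; lia.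
have [b bs b0] : exists2 b, b < s & j - k = b.+1 by exists (j - k).-1; lia.
have {}ak : a < k by lia.
rewrite a0 b0 /=; apply/subsetP=> x /setIP[xG1 xG2].
have [y1 [z1 [c1 [yT1 zR1 cU1 xE1]]]] := glue_split ak (ltnW bs) xG1.
have [y2 [z2 [c2 [yT2 zR2 cU2 xE2]]]] := glue_split (ltnW ak) bs xG2.
(* Stripping factors that lie in [G a b] leaves an element whose support is bounded by both normal
   forms: the first confines it on the side of [B], the second on the side of [A]. *)
pose x' := y2^-1 * x * z1^-1.
have xE : x = y2 * x' * z1 by rewrite /x' !mulgA mulgV mul1g mulgKV.
have yG : y2 \in G a b by apply: (subsetP (joing_subl _ _)).
have zG : z1 \in G a b by apply: (subsetP (joing_subr _ _)).
pose GG := (T a <*> R b)%G; suff x'G : x' \in GG by rewrite xE; apply: (groupM (groupM (yG : _ \in GG) x'G) zG).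
have on1 : perm_on (A :|: OQ b) x'.
  have -> : x' = (y2^-1 * y1) * (c1 ^ z1^-1).
    by rewrite /x' xE1 conjgE invgK !mulgA.
  apply: perm_onM.
    apply: (perm_onS (subsetUl _ _)); apply: (@T_on a.+1) => //.
    by rewrite groupM // groupV (subsetP (itvS _ _ _) _ yT2).
  apply: (@perm_onS _ (U a.+1 b)).
    by rewrite setSU // OT_sub.
  by apply: perm_onJ cU1 => z; apply: (R_U ak (ltnW bs)); rewrite groupV.
have on2 : perm_on (B :|: OT a) x'.
  have -> : x' = (z2 * z1^-1) * (c2 ^ z1^-1).
    by rewrite /x' xE2 conjgE invgK !mulgA mulVg mul1g mulgKV.
  have z1R : z1^-1 \in R b.+1 by rewrite groupV (subsetP (itvS _ _ _) _ zR1).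
  apply: perm_onM.
    by apply: (perm_onS (subsetUl _ _)); apply: (@R_on b.+1) => //; rewrite groupM.
  apply: (@perm_onS _ (U a b.+1)).
    by rewrite /U setUC setSU // OQ_sub.
  by apply: perm_onJ cU2 => z; apply: (R_U (ltnW ak) bs).
have on3 : perm_on (U a b) x'.
  apply: perm_onS (perm_onI on1 on2); apply/subsetP=> y; rewrite !inE.
  case/andP=> /orP[yA|->]; last by rewrite orbT.
  by case/orP=> [yB|->//]; rewrite (memAB yA yB) orb_refl.
have T0 : T 0 = 1 by apply: itv_nil.
have R0 : R 0 = 1 by apply: itv_nil.
(* If both are zero, only [v] could move; if one is zero, the star condition of the other piece
   applies; otherwise [x'] is even on [U a b] and [glue_alt] applies. *)
case: (posnP a) => [a1|a1]; case: (posnP b) => [b1|b1].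
- have : perm_on [set v] x' by move: on3; rewrite /U a1 b1 /OT /OQ T0 R0 !orb1 setUid.
  by move=> /perm_on_id ->; rewrite ?cards1 ?group1.
- have x'R : x' \in R b.+1.
    have xR : x \in R b.+1 by move: xG2; rewrite /G a1 T0 joing1G.
    move: yT2; rewrite a1 T0 => /set1P y21.
    rewrite /x' y21 invg1 mul1g groupM // groupV (subsetP (itvS _ _ _) _ zR1) //.
  apply: (subsetP (joing_subr _ _)); apply: (piece_star qP) => //.
  by apply: perm_onS on3; rewrite /U a1 /OT T0 orb1 subUset sub1set orb_refl subxx.
- have x'T : x' \in T a.+1.
    have xT : x \in T a.+1 by move: xG1; rewrite /G b1 R0 joingG1.
    move: zR1; rewrite b1 R0 => /set1P z11.
    by rewrite /x' z11 invg1 mulg1 groupM // groupV (subsetP (itvS _ _ _) _ yT2).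
  apply: (subsetP (joing_subl _ _)); apply: (piece_star tP) => //.
  by apply: perm_onS on3; rewrite /U b1 /OQ R0 orb1 subUset sub1set orb_refl subxx.
apply: glue_alt => //; rewrite ?(ltnW ak) ?(ltnW bs) //.
have GA a' b' : a' <= k -> b' <= s -> G a' b' \subset 'Alt_X.
  by move=> ha hb; rewrite join_subG T_even ?R_even.
rewrite -Alt_even /x' !groupM ?groupV //.
- exact: (subsetP (T_even (ltnW ak))).
- exact: (subsetP (GA _ _ ak (ltnW bs))).
exact: (subsetP (R_even (ltnW bs))).
Qed.
End Glue.

(** * Transport along injections *)

Section StringMorphism.
Variables (aT rT : finGroupType) (f : {morphism [set: aT] >-> rT}).
Hypothesis f_inj : 'injm f.
Implicit Types q : nat -> aT.

Lemma itv_morphim q i j : itv (f \o q) i j = f @* itv q i j.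
Proof.
apply/eqP; rewrite eqEsubset; apply/andP; split.
  apply: itv_sub => l h1 h2; apply: mem_morphim; rewrite ?inE //.
  exact: mem_itv.
rewrite sub_morphim_pre ?subsetT //; apply: itv_sub => l h1 h2.
by rewrite !inE; apply: (@mem_itv _ (f \o q)).
Qed.

Lemma stringC_morphim q s : stringC q s -> stringC (f \o q) s.
Proof.
have fM x y : f (x * y) = f x * f y by rewrite morphM ?inE.
have fI x y : f x = f y -> x = y by move/(injmP f_inj); apply; rewrite inE.
case=> inv comm ip; split.
- move=> i ir; have [n1 i1] := inv i ir; split; last by rewrite /= -fM i1 morph1.
  by apply: contra n1 => /eqP h; apply/eqP/fI; rewrite /= in h; rewrite h morph1.
- by move=> i j ij jr; rewrite /commute /= -!fM comm.
move=> i j ij jr; rewrite !itv_morphim -injmI ?subsetT // morphimS //.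
exact: ip.
Qed.
End StringMorphism.

Section PushPiece.
Variables (Y X : finType) (h : Y -> X) (h_inj : injective h).

Let f := push_morphism h_inj.

Lemma push_orb (H : {set {perm Y}}) v : orb (f @* H) (h v) = h @: orb H v.
Proof.
apply/setP=> y; apply/orbP/imsetP=> [[x /morphimP[z _ zH ->] ->]|[w /orbP[x xH ->] ->]].
  by exists (z v); [apply/orbP; exists z | rewrite /= pushE].
by exists (f x); rewrite ?mem_morphim ?inE //= pushE.
Qed.

Lemma piece_push v s q : piece setT v s q ->
  piece (h @: setT) (h v) s (push h_inj \o q).
Proof.
move=> [s0 str _ ev fx st tr].
have fE i j : itv (push h_inj \o q) i j = f @* itv q i j by rewrite -itv_morphim.
split=> //.
- exact: (stringC_morphim (push_injm h_inj) str).
- move=> i ir; apply/subsetP=> x; rewrite inE; apply: contraR => xh.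
  rewrite push_out //; apply: contra xh => /codomP[y ->].
  by apply: imset_f.
- by move=> i ir; rewrite /= odd_push ev.
- by move=> i i0 ir; rewrite /= pushE fx.
- move=> j x j0 js; rewrite !fE push_orb => /morphimP[y _ yq ->] yon.
  rewrite mem_morphim ?inE //; apply: st => //.
  apply/subsetP=> z; rewrite inE => yz.
  have : h z \in h @: orb (itv q 0 j) v.
    by apply: (subsetP yon); rewrite inE /= pushE (inj_eq h_inj).
  by case/imsetP=> w wo /h_inj ->.
- move=> y /imsetP[z _ ->]; rewrite fE push_orb; apply: imset_f.
  by apply: tr; rewrite inE.
Qed.
End PushPiece.

Definition realized (X : finType) (r : nat) (rho : nat -> {perm X}) :=
  stringC rho r /\ itv rho 0 r = 'Alt_X.

Lemma realized_push (X Y : finType) (h : X -> Y) (h_inj : injective h) r rho :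
  #|X| = #|Y| -> realized r rho -> realized r (push h_inj \o rho).
Proof.
move=> cXY [str gen]; split; first exact: (stringC_morphim (push_injm h_inj) str).
have -> : itv (push h_inj \o rho) 0 r = push_morphism h_inj @* itv rho 0 r.
  by rewrite -itv_morphim.
rewrite gen; apply/eqP; rewrite eqEcard; apply/andP; split.
  by apply/subsetP=> _ /morphimP[x _ xA ->]; rewrite Alt_even /= odd_push -Alt_even.
rewrite card_injm ?subsetT ?push_injm //.
have [Y1|Y1] := leqP #|Y| 1.
  have Y2 : #|Y| <= 2 by apply: leq_trans Y1 _.
  by rewrite !trivial_Alt_2 ?cXY // !cards1.
by rewrite -(leq_pmul2l (ltn0Sn 1)) !card_Alt ?cXY.
Qed.

Lemma realized_ord (X : finType) n r rho : #|X| = n -> @realized X r rho ->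
  exists s : 'I_r -> {perm 'I_n}, string_C_group ('Alt_('I_n)) s.
Proof.
move=> <- rX; have rI : injective (@enum_rank X) by apply: enum_rank_inj.
have [str gen] := realized_push rI (esym (card_ord #|X|)) rX.
by exists (fun i => push rI (rho i)); rewrite -gen; apply: (stringC_group str).
Qed.

Lemma realized_contract (X : finType) r rho m : 4 < #|X| -> @realized X r rho ->
    m.+3 <= r -> (forall i, i < m -> odd #[rho i.+2 * rho i.+3]) ->
  exists s, @realized X (r - m) s.
Proof.
move=> X5 [str gen] mr hodd.
have simG : simple (itv rho 0 r) by rewrite gen; apply: simple_Alt5.
have [s strs gens] := contract_iter str simG mr hodd.
by exists s; split; rewrite ?gens.
Qed.

Section GlueTypes.
Variables (Y Z : finType) (v : Y) (w : Z) (k s : nat).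
Variables (t : nat -> {perm Y}) (q : nat -> {perm Z}).
Hypotheses (tP : piece setT v k t) (qP : piece setT w s q).

(** The one-point union, with [w] removed from [Z] and represented by [v]; [wedger] is the resulting
    embedding of [Z]. *)
Definition wedge := (Y + {z : Z | z != w})%type.
HB.instance Definition _ := Finite.on wedge.

Definition wedgel (y : Y) : wedge := inl y.
Definition wedger (z : Z) : wedge := if insub z is Some u then inr u else inl v.

Lemma wedgel_inj : injective wedgel.
Proof. by move=> y y' []. Qed.

Lemma wedger_inj : injective wedger.
Proof.
move=> z z'; rewrite /wedger; case: insubP => [u uw uz|/negbNE/eqP->];
  case: insubP => [u' uw' uz'|/negbNE/eqP->] //.
by case=> uu; rewrite -uz -uz' uu.
Qed.

Lemma wedger0 : wedger w = wedgel v.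
Proof. by rewrite /wedger insubF ?eqxx. Qed.

Lemma card_wedge : #|{: wedge}|.+1 = #|Y| + #|Z|.
Proof.
rewrite card_sum card_sig -addnS; congr addn.
by rewrite -(cardC (pred1 w)) card1 add1n; congr S; apply: eq_card.
Qed.

Definition wedge_gens := glue k (push wedgel_inj \o t) (push wedger_inj \o q).

Lemma wedgeP : realized (k + s) wedge_gens.
Proof.
apply: (@glueP _ (wedgel @: setT) (wedger @: setT) (wedgel v)).
- exact: piece_push.
- by rewrite -wedger0; apply: piece_push.
- apply/setP=> x; rewrite !inE; apply/andP/eqP=> [[/imsetP[y _ ->] /imsetP[z _]]|->].
    by rewrite /wedger; case: insubP => // _ [].
  by split; [apply: imset_f | rewrite -wedger0; apply: imset_f].
apply/setP=> -[y|u]; rewrite !inE; first by rewrite imset_f.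
apply/orP; right; apply/imsetP; exists (val u) => //.
by rewrite /wedger valK.
Qed.

Lemma order_wedgel i : i.+1 < k ->
  #[wedge_gens i * wedge_gens i.+1] = #[t (k.-1 - i) * t (k.-1 - i.+1)].
Proof.
move=> ik; rewrite /wedge_gens /glue ltnW // ik /= -pushM.
exact: (order_injm (push_injm wedgel_inj)).
Qed.

Lemma order_wedger i : k <= i ->
  #[wedge_gens i * wedge_gens i.+1] = #[q (i - k) * q (i.+1 - k)].
Proof.
move=> ki; rewrite /wedge_gens /glue !ltnNge ki (leqW ki) /= -pushM.
exact: (order_injm (push_injm wedger_inj)).
Qed.
End GlueTypes.

(* Junk value [1] if [F] is not injective. *)
Definition fperm (T : finType) (F : T -> T) : {perm T} := insubd (1 : {perm T}) [ffun x => F x].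

Lemma fpermE (T : finType) (F : T -> T) : injective F -> fperm F =1 F.
Proof.
move=> FI x; rewrite -pvalE /fperm val_insubd.
case: ifP => [_|/injectiveP[]]; first by rewrite ffunE.
by move=> y z; rewrite !ffunE => /FI.
Qed.

Lemma fperm2 (T : finType) (F : T -> T) : involutive F -> fperm F * fperm F = 1.
Proof.
by move=> FK; apply/permP=> x; rewrite permM perm1 !(fpermE (inv_inj FK)) FK.
Qed.

Lemma itv_single (gT : finGroupType) (q : nat -> gT) i x :
  q i * q i = 1 -> x \in itv q i i.+1 -> x = 1 \/ x = q i.
Proof.
move=> qi xq; have /cycleP[m ->] : x \in <[q i]>.
  apply: (subsetP (itv_sub _)) xq => l h1 h2.
  have -> : l = i by apply/eqP; rewrite eqn_leq h1 -ltnS h2.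
  exact: cycle_id.
rewrite -(odd_double_half m) expgD -mul2n expgM (qi : q i ^+ 2 = 1) expg1n mulg1.
by case: (odd m); [right; rewrite expg1 | left].
Qed.

(** * Path pieces *)

Section Path.
Variable t : nat.
(** With this many points each of the two generators fixes one end of the path and is a product of
    2t+2 transpositions, hence even. *)
Let N := (4 * t).+4.+1.
Notation P := 'I_N.

(* [path0] swaps 0-1, 2-3, ..., and [path1] swaps 1-2, 3-4, ... *)
Definition path0 (x : P) : P := inord (if odd x then x.-1 else if x.+1 < N then x.+1 else x).
Definition path1 (x : P) : P := inord (if odd x then x.+1 else x.-1).

Lemma path0E x : path0 x = (if odd x then x.-1 else if x.+1 < N then x.+1 else x) :> nat.
Proof.
rewrite inordK //; have := ltn_ord x; rewrite /N; case: ifP => [|_]; first lia.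
by case: ifP; lia. Qed.

Lemma path1E x : path1 x = (if odd x then x.+1 else x.-1) :> nat.
Proof. by rewrite inordK //; have := ltn_ord x; rewrite /N; case: ifP; lia. Qed.

Lemma path0K : involutive path0.
Proof.
move=> x; apply: val_inj; rewrite /= path0E; have := path0E x.
by have := ltn_ord x; do ?[case: ifP]; rewrite /N; lia.
Qed.

Lemma path1K : involutive path1.
Proof.
move=> x; apply: val_inj; rewrite /= path1E; have := path1E x.
by do ?[case: ifP]; lia.
Qed.

Definition path_gens i : {perm P} := if i is 0 then fperm path0 else fperm path1.

Lemma path_piece : piece setT (ord0 : P) 2 path_gens.
Proof.
have p0 : fperm path0 =1 path0 by apply/fpermE/inv_inj/path0K.
have p1 : fperm path1 =1 path1 by apply/fpermE/inv_inj/path1K.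
have inv i : path_gens i * path_gens i = 1.
  by case: i => [|i]; apply: fperm2; [apply: path0K | apply: path1K].
have pg0 : path_gens 0 ord0 != ord0 by rewrite /= p0 -val_eqE /= path0E.
have pg1 : path_gens 1%N ord0 = ord0 by rewrite /= p1; apply: val_inj; rewrite /= path1E.
have ev i : ~~ odd_perm (path_gens i).
  rewrite odd_involution ?inv //.
  suff [z ->] : exists z, [set x | path_gens i x != x] = [set~ z].
    by rewrite cardsC1 card_ord /N /=; lia.
  case: i => [|i]; [exists ord_max | exists ord0]; apply/setP=> x; rewrite !inE /=.
    rewrite p0 -!val_eqE /= path0E; have := ltn_ord x; rewrite /N.
    by do ?[case: ifP]; lia.
  rewrite p1 -!val_eqE /= path1E; have := ltn_ord x; rewrite /N.
  by do ?[case: ifP]; lia.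
split=> //.
- split.
  + move=> i i2; split=> //; case: i i2 => [|[|//]] _.
      by apply: contraNneq pg0 => ->; rewrite perm1.
    apply/eqP=> /permP/(_ (inord 1)); rewrite perm1 /= p1 => /(congr1 val) /=.
    by rewrite path1E !inordK.
  + by move=> i j; lia.
  move=> [|i] [|[|[|j]]] // _ _; apply/subsetP=> x /setIP[].
  move=> /(itv_single (inv 0)) [->|->]; first by rewrite group1.
  move=> /(itv_single (inv 1%N)) [->|e]; first by rewrite group1.
  by move: pg0; rewrite e pg1 eqxx.
- by move=> i i2; apply/subsetP=> x; rewrite inE.
- by move=> [|[|//]] // _ _.
- move=> [|[|//]] x // _ _ xq xo.
  (* The orbit under the first generator has two points, and an even permutation of two points is
     trivial. *)
  suff -> : x = 1 by rewrite group1.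
  have xe : ~~ odd_perm x.
    rewrite -Alt_even; apply: (subsetP (itv_sub _)) xq => l _ _; rewrite Alt_even; exact: ev.
  have {}xo : perm_on [set ord0; path_gens 0 ord0] x.
    apply: perm_onS xo; apply/subsetP=> y /orbP[z /(itv_single (inv 0))[->|->] ->].
      by rewrite perm1 !inE eqxx.
    by rewrite !inE eqxx orbT.
  have [//|x0] := eqVneq x 1.
  have x00 : x ord0 != ord0.
    apply: contraNneq x0 => x00; apply/eqP; apply: (perm_on_id (perm_on_fix xo x00)).
    apply: leq_trans (subset_leq_card (_ : _ \subset [set path_gens 0 ord0])) _.
      by apply/subsetP=> y; rewrite !inE => /andP[/negPf->].
    by rewrite cards1.
  have x0E : x ord0 = path_gens 0 ord0.
    by have := perm_closed ord0 xo; rewrite !inE eqxx (negPf x00) => /eqP.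
  suff xE : x = tperm ord0 (path_gens 0 ord0) by rewrite xE odd_tperm eq_sym pg0 in xe.
  apply/permP=> y; case: tpermP => [->//|->|/eqP y0 /eqP y1].
    have := perm_closed (path_gens 0 ord0) xo; rewrite !inE eqxx orbT => /orP[/eqP//|].
    by move=> /eqP; rewrite -{2}x0E => /perm_inj/eqP; rewrite (negPf pg0).
  by apply: (out_perm xo); rewrite !inE negb_or y0.
- move=> y _; have [m] := ubnP (y : nat); elim: m y => // m IH y ym.
  have [y0|y0] := posnP y; first by rewrite (_ : y = ord0) ?orb_refl //; apply: val_inj.
  have mem i : i < 2 -> path_gens i \in itv path_gens 0 2 by move=> i2; apply: mem_itv.
  have zN : y.-1 < N by apply: leq_ltn_trans (leq_pred _) (ltn_ord y).
  (* Walk along the path: [path0] steps into odd points and [path1] into positive even ones. The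
     boolean is coerced to the index. *)
  have yE : y = path_gens (~~ odd y) (Ordinal zN).
    apply: val_inj; case: (boolP (odd y)) => oy /=.
      by rewrite p0 path0E /=; have := ltn_ord y; do ?[case: ifP]; lia.
    by rewrite p1 path1E /=; have := ltn_ord y; do ?[case: ifP]; lia.
  rewrite yE; apply: orb_stable; first by apply: mem; case: (odd y).
  by apply: IH => /=; lia.
Qed.
End Path.

(** * Small degree examples by computation *)

(* Finite sets of words as prefix trees, so that closure computations run fast in the kernel. *)
Inductive trie := Trie of bool & seq trie.

Definition trie0 := Trie false [::].

Fixpoint tmem t (w : seq nat) :=
  let: Trie b ts := t in if w is a :: w' then tmem (nth trie0 ts a) w' else b.

Fixpoint tins (w : seq nat) t :=
  let: Trie b ts := t in
  if w is a :: w' then Trie b (set_nth trie0 ts a (tins w' (nth trie0 ts a))) else Trie true ts.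

Definition trie_of (s : seq (seq nat)) := foldr tins trie0 s.

Lemma tmem0 w : tmem trie0 w = false.
Proof. by elim: w => //= a w; rewrite nth_nil. Qed.

Lemma tmem_ins w t u : tmem (tins w t) u = (u == w) || tmem t u.
Proof.
elim: w t u => [|a w IH] [b ts] [|c u] //=.
by rewrite nth_set_nth /= eqseq_cons; have [->|] //= := eqVneq c a.
Qed.

Lemma trie_ofE s w : tmem (trie_of s) w = (w \in s).
Proof. by elim: s => [|u s IH]; rewrite ?tmem0 //= tmem_ins IH inE. Qed.

(** * Permutation groups given by tables of images *)

Section Tables.
Variable n : nat.
Local Notation P := 'I_n.+1.
Implicit Types (l w : seq nat) (ls : seq (seq nat)).

Definition tmul w l := [seq nth 0 l a | a <- w].

Definition tab_ok l := [&& all (fun a => nth 0 l a < n.+1) (iota 0 n.+1) &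
  all (fun a => nth 0 l (nth 0 l a) == a) (iota 0 n.+1)].

Lemma ord_iota (x : P) : (x : nat) \in iota 0 n.+1.
Proof. by rewrite mem_iota add0n ltn_ord. Qed.

Definition tperm_of l : {perm P} := fperm (fun x : P => inord (nth 0 l x)).

Definition rep (x : {perm P}) : seq nat := [seq val (x i) | i <- enum P].

Lemma rep_inj : injective rep.
Proof.
move=> x y /eq_in_map xy; apply/permP=> i; apply: val_inj.
by apply: xy; rewrite mem_enum.
Qed.

Lemma rep1 : rep 1 = iota 0 n.+1.
Proof. by rewrite /rep -val_enum_ord; apply: eq_map => i; rewrite perm1. Qed.

Lemma nth_rep x (i : P) : nth 0 (rep x) i = x i.
Proof. by rewrite (nth_map i) ?size_enum_ord // nth_ord_enum. Qed.

Lemma tab_involutive l : tab_ok l -> involutive (fun x : P => inord (nth 0 l x) : P).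
Proof.
case/andP=> /allP lt /allP inv x.
have x_in := ord_iota x.
by rewrite (inordK (lt _ x_in)) (eqP (inv _ x_in)) inord_val.
Qed.

Lemma tperm_ofE l (x : P) : tab_ok l -> tperm_of l x = nth 0 l x :> nat.
Proof.
move=> lok; rewrite (fpermE (inv_inj (tab_involutive lok))) inordK //.
by case/andP: lok => /allP lt _; apply/lt/ord_iota.
Qed.

Lemma repM x l : tab_ok l -> rep (x * tperm_of l) = tmul (rep x) l.
Proof.
by move=> lok; rewrite /rep /tmul -map_comp; apply: eq_map => i /=; rewrite permM tperm_ofE.
Qed.

Fixpoint tadd t new cand :=
  if cand is w :: cand' then
    if tmem t w then tadd t new cand' else tadd (tins w t) (w :: new) cand'
  else (t, new).

Fixpoint closure ls m t (seen fr : seq (seq nat)) :=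
  if m is m'.+1 then
    let: (t', new) := tadd t [::] [seq tmul w l | w <- fr, l <- ls] in
    if new is [::] then seen else closure ls m' t' (new ++ seen) new
  else seen.

(* 30 rounds of breadth-first search suffice for the groups below; [tclosed] checks it. *)
Definition tclos ls :=
  let id := iota 0 n.+1 in closure ls 30 (tins id trie0) [:: id] [:: id].

Definition tclosed ls (L : seq (seq nat)) :=
  let t := trie_of L in
  tmem t (iota 0 n.+1) && all (fun w => all (fun l => tmem t (tmul w l)) ls) L.

Fixpoint porbit ls m (seen fr : seq nat) :=
  if m is m'.+1 then
    let new := undup [seq a <- [seq nth 0 l a | a <- fr, l <- ls] | a \notin seen] in
    porbit ls m' (new ++ seen) new
  else seen.

Definition porb ls := porbit ls n.+1 [:: 0] [:: 0].

Definition pclosed ls (O : seq nat) := (0 \in O) && all (fun a => all (fun l => nth 0 l a \in O) ls) O.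

Variable ls : seq (seq nat).
Definition tgens i := tperm_of (nth [::] ls i).
Definition sub i j := [seq nth [::] ls k | k <- iota i (j - i)].
Definition tG i j := tclos (sub i j).

Hypothesis ls_ok : all tab_ok ls.

Lemma nth_ok k : k < size ls -> tab_ok (nth [::] ls k).
Proof. by move=> ks; apply: (allP ls_ok); apply: mem_nth. Qed.

Lemma tadd_sub t new cand w : w \in (tadd t new cand).2 -> w \in new \/ w \in cand.
Proof.
elim: cand t new => [|u cand IH] t new /=; first by left.
case: ifP => _ /IH; rewrite !inE; first by case; [left|right; apply/orP; right].
by case=> [/orP[->|]|->]; [right|left|right; rewrite orbT].
Qed.

Lemma closure_sound i j m t seen fr w : j <= size ls ->
    (forall w, w \in seen -> exists2 x, x \in itv tgens i j & rep x = w) ->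
    (forall w, w \in fr -> exists2 x, x \in itv tgens i j & rep x = w) ->
  w \in closure (sub i j) m t seen fr -> exists2 x, x \in itv tgens i j & rep x = w.
Proof.
move=> js; elim: m t seen fr => [|m IH] t seen fr hs hf //=; first exact: hs.
case E: (tadd _ _ _) => [t' new].
have hnew w' : w' \in new -> exists2 x, x \in itv tgens i j & rep x = w'.
  have -> : new = (t', new).2 by []; rewrite -E => /tadd_sub[//|].
  case/allpairsP=> -[u l] /= [uf].
  case/mapP=> k; rewrite mem_iota => kij -> ->.
  have [x xq <-] := hf u uf; exists (x * tgens k); last by rewrite repM // nth_ok //; lia.
  by rewrite groupM // mem_itv //; lia.
case: new hnew {E} => [|a new] hnew; first exact: hs.
by apply: IH => // w'; rewrite mem_cat => /orP[/hnew|/hs].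
Qed.

Lemma tG_sound i j w : j <= size ls -> w \in tG i j ->
  exists2 x, x \in itv tgens i j & rep x = w.
Proof.
have h1 w' : w' \in [:: iota 0 n.+1] -> exists2 x, x \in itv tgens i j & rep x = w'.
  by rewrite inE => /eqP ->; exists 1; rewrite ?group1 ?rep1.
by move=> js; apply: closure_sound.
Qed.

(** The elements whose right multiplication preserves [L] form a group; by the check it contains the
    generators, and [L] contains the identity. So a successful check makes the list complete
    whatever the bound on the search. *)
Lemma tclosed_complete i j L x : j <= size ls -> tclosed (sub i j) L ->
  x \in itv tgens i j -> rep x \in L.
Proof.
rewrite /tclosed trie_ofE => js /andP[idL /allP cl].
pose K := [set x : {perm P} | [forall y, (rep y \in L) ==> (rep (y * x) \in L)]].
have KP z : reflect (forall y, rep y \in L -> rep (y * z) \in L) (z \in K).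
  by rewrite inE; apply: (iffP forallP) => h y; [apply/implyP | apply/implyP/h].
have gK : group_set K.
  apply/group_setP; split; first by apply/KP=> y; rewrite mulg1.
  by move=> z1 z2 /KP h1 /KP h2; apply/KP=> y yL; rewrite mulgA h2 ?h1.
have sub_K : itv tgens i j \subset Group gK.
  apply: itv_sub => k ik kj; apply/KP=> y yL; rewrite repM ?nth_ok //; last lia.
  by rewrite -trie_ofE; apply: (allP (cl _ yL)); apply/mapP; exists k; rewrite // mem_iota; lia.
by move=> /(subsetP sub_K)/KP/(_ 1); rewrite mul1g rep1; apply.
Qed.

Definition ip_ok i j :=
  let A := tG i j.-1 in let B := tG i.+1 j in let C := tG i.+1 j.-1 in
  [&& tclosed (sub i j.-1) A, tclosed (sub i.+1 j) B &
      let tB := trie_of B in let tC := trie_of C in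
      (* An explicit conditional keeps call-by-value evaluation from doing the second lookup when
         the first fails. *)
      all (fun w => if tmem tB w then tmem tC w else true) A].

Definition str_ok :=
  [&& all (fun l => l != iota 0 n.+1) ls, all (fun l => size l == n.+1) ls,
      all (fun j => all (fun i => (i.+1 < j) ==>
        (tmul (nth [::] ls i) (nth [::] ls j) == tmul (nth [::] ls j) (nth [::] ls i)))
          (iota 0 j)) (iota 0 (size ls)) &
      all (fun j => all (fun i => (i.+1 < j) ==> ip_ok i j) (iota 0 j)) (iota 0 (size ls).+1)].

Lemma rep_tperm_of l : tab_ok l -> size l = n.+1 -> rep (tperm_of l) = l.
Proof.
move=> lok sl; rewrite -[tperm_of l]mul1g repM // rep1 /tmul.
by rewrite -sl; apply: (@eq_from_nth _ 0); rewrite size_map size_iota // => k ks;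
  rewrite (nth_map 0) ?size_iota // nth_iota.
Qed.

Lemma str_okP : str_ok -> stringC tgens (size ls).
Proof.
case/and4P=> /allP n1 /allP sz /allP cm /allP ip; split.
- move=> k ks; have lk := mem_nth [::] ks; split; last exact/fperm2/tab_involutive/nth_ok.
  apply: contra (n1 _ lk) => /eqP k1; rewrite -rep1 -k1 rep_tperm_of ?nth_ok //.
  exact/eqP/sz.
- move=> i j ij js; have is_ : i < size ls by lia.
  have szi : size (nth [::] ls i) = n.+1 by apply/eqP/sz/mem_nth.
  have szj : size (nth [::] ls j) = n.+1 by apply/eqP/sz/mem_nth.
  apply: rep_inj; rewrite !repM ?nth_ok // !rep_tperm_of ?nth_ok //.
  have jI : j \in iota 0 (size ls) by rewrite mem_iota.
  have iI : i \in iota 0 j by rewrite mem_iota; lia.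
  exact/eqP/(implyP (allP (cm j jI) i iI)).
move=> i j ij js.
have jI : j \in iota 0 (size ls).+1 by rewrite mem_iota.
have iI : i \in iota 0 j by rewrite mem_iota; lia.
have := implyP (allP (ip j jI) i iI) ij; rewrite /ip_ok => /and3P[cA cB /allP AC].
apply/subsetP=> x /setIP[/(tclosed_complete _ cA) xA /(tclosed_complete _ cB) xB].
have := AC _ (xA (leq_trans (leq_pred j) js)); rewrite !trie_ofE (xB js).
by move=> /(tG_sound (leq_trans (leq_pred j) js))[y yq /rep_inj <-].
Qed.

Definition torb j := porb (sub 0 j).

Definition star_ok j :=
  let A := tG 0 j.+1 in let B := tG 0 j in let O := torb j in
  [&& tclosed (sub 0 j.+1) A, pclosed (sub 0 j) O &
    let tB := trie_of B in
    all (fun w => if all (fun a => if nth 0 w a == a then true else a \in O) (iota 0 n.+1)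
                  then tmem tB w else true) A].

Lemma porbit_sound i j m seen fr a : j <= size ls ->
    (forall a, a \in seen -> exists2 y, y \in orb (itv tgens i j) ord0 & a = val y) ->
    (forall a, a \in fr -> exists2 y, y \in orb (itv tgens i j) ord0 & a = val y) ->
  a \in porbit (sub i j) m seen fr ->
  exists2 y, y \in orb (itv tgens i j) ord0 & a = val y.
Proof.
move=> js; elim: m seen fr => [|m IH] seen fr hs hf //=; first exact: hs.
set new := undup _.
have hnew b : b \in new -> exists2 y, y \in orb (itv tgens i j) ord0 & b = val y.
  rewrite mem_undup mem_filter => /andP[_ /allpairsP[[c l] /= [cf]]].
  case/mapP=> k; rewrite mem_iota => kij -> ->; have [y yO ->] := hf c cf.
  exists (tgens k y); last by rewrite tperm_ofE // nth_ok //; lia.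
  by apply: orb_stable yO; apply: mem_itv; lia.
by apply: IH => // b; rewrite mem_cat => /orP[/hnew|/hs].
Qed.

Lemma torb_sound j a : j <= size ls -> a \in torb j ->
  exists2 y, y \in orb (itv tgens 0 j) ord0 & a = val y.
Proof.
move=> js; apply: porbit_sound => // b; rewrite inE => /eqP ->;
  by exists ord0; rewrite ?orb_refl.
Qed.

Lemma pclosed_complete j O y : j <= size ls -> pclosed (sub 0 j) O ->
  y \in orb (itv tgens 0 j) ord0 -> val y \in O.
Proof.
move=> js /andP[O0 /allP cl].
pose K := [set x : {perm P} | [forall y : P, (val y \in O) ==> (val (x y) \in O)]].
have KP (z : {perm P}) : reflect (forall y : P, val y \in O -> val (z y) \in O) (z \in K).
  by rewrite inE; apply: (iffP forallP) => h b; [apply/implyP | apply/implyP/h].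
have gK : group_set K.
  apply/group_setP; split; first by apply/KP=> b; rewrite perm1.
  by move=> z1 z2 /KP h1 /KP h2; apply/KP=> b bO; rewrite permM h2 ?h1.
have sub_K : itv tgens 0 j \subset Group gK.
  apply: itv_sub => k ik kj; apply/KP=> b bO; rewrite /= tperm_ofE ?nth_ok //; last lia.
  by apply: (allP (cl _ bO)); apply/mapP; exists k; rewrite // mem_iota; lia.
by case/orbP=> x /(subsetP sub_K)/KP h ->; apply: h.
Qed.

Definition piece_ok :=
  [&& 0 < size ls, str_ok,
   all (fun l => ~~ odd (count (fun a => nth 0 l a != a) (iota 0 n.+1))./2) ls,
   all (fun l => nth 0 l 0 == 0) (behead ls),
   all star_ok (iota 1 (size ls).-1) &
   all (fun a => a \in torb (size ls)) (iota 0 n.+1)].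

Lemma piece_okP : piece_ok -> piece setT (ord0 : P) (size ls) tgens.
Proof.
case/and5P=> s0 sok /allP ev /allP fx /andP[/allP st /allP tr].
split=> //; first exact: str_okP.
- by move=> i _; apply/subsetP=> x; rewrite inE.
- move=> i is_; have iok := nth_ok is_; rewrite odd_involution; last exact/fperm2/tab_involutive.
  have := ev _ (mem_nth [::] is_); congr (~~ odd _./2).
  rewrite -(val_enum_ord n.+1) count_map cardE /enum_mem -enumT size_filter.
  by rewrite filter_predT; apply: eq_count => x; rewrite /= inE -val_eqE /= tperm_ofE.
- move=> i i0 is_; apply: val_inj; rewrite /= tperm_ofE ?nth_ok //; apply/eqP.
  case: i i0 is_ => // i _ is_; apply: (fx (nth [::] ls i.+1)).
  by rewrite -nth_behead mem_nth // size_behead -ltnS (ltn_predK is_).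
- move=> j x j0 js xq xo.
  have jI : j \in iota 1 (size ls).-1 by rewrite mem_iota; lia.
  have := st j jI; rewrite /star_ok => /and3P[cA cB /allP AB].
  have := AB _ (tclosed_complete js cA xq); rewrite ifT.
    by rewrite trie_ofE => /(tG_sound (ltnW js))[y yq /rep_inj <-].
  apply/allP=> a; rewrite mem_iota add0n => an.
  rewrite (nth_rep x (Ordinal an)) -[X in _ == X](_ : val (Ordinal an) = a) // val_eqE.
  case: eqP => // /eqP xa.
  by apply: (pclosed_complete (ltnW js) cB (y := Ordinal an)); apply: (subsetP xo); rewrite inE.
- move=> y _; have /tr/(torb_sound (leqnn _))[z zo yz] := ord_iota y.
  by rewrite (val_inj yz).
Qed.

Definition tword (u : seq nat) := foldl tmul (iota 0 n.+1) [seq nth [::] ls k | k <- u].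

Lemma rep_word (u : seq nat) : all (fun k => k < size ls) u ->
  rep (\prod_(k <- u) tgens k) = tword u.
Proof.
rewrite /tword; elim/last_ind: u => [|u k IH]; first by rewrite big_nil rep1.
rewrite all_rcons => /andP[ks us]; rewrite -cats1 big_cat big_seq1 /=.
by rewrite repM ?nth_ok // IH // map_cat foldl_cat.
Qed.

Lemma odd_order_tab i j m : i < size ls -> j < size ls -> odd m ->
  tword (flatten (nseq m [:: i; j])) = iota 0 n.+1 -> odd #[tgens i * tgens j].
Proof.
move=> is_ js om; set u := flatten _ => uE.
have us : all (fun k => k < size ls) u.
  by apply/allP=> k /flattenP[w /nseqP[-> _]]; rewrite !inE => /orP[]/eqP->.
apply: dvdn_odd om; rewrite order_dvdn; apply/eqP/rep_inj.
rewrite rep1 -uE -rep_word // /u; congr rep; elim: (m) => [|k IH] /=; first by rewrite big_nil.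
by rewrite expgS IH !big_cons mulgA.
Qed.
End Tables.

(** Jordan's relation is invariant under the group, so the elements sending [v] into its own class
    form a subgroup. It suffices to test generators; by transitivity the class is everything. *)
Lemma Alt_sub_c3 (X : finType) (rho : nat -> {perm X}) r (v : X) :
    (forall y, y \in orb (itv rho 0 r) v) ->
    (forall i, i < r -> c3_rel (itv_group rho 0 r) v (rho i v)) ->
  'Alt_X \subset itv rho 0 r.
Proof.
set G := itv_group rho 0 r => tr hi.
pose K := [set x in G | c3_rel G v (x v)].
have gK : group_set K.
  apply/group_setP; split; first by rewrite inE group1 perm1; apply/c3_relP; left.
  move=> x y; rewrite !inE => /andP[xG vx] /andP[yG vy]; rewrite groupM //= permM.
  exact: c3_rel_trans vy (c3_rel_perm yG vx).
have KG : G \subset Group gK.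
  by apply: itv_sub => i _ ir; rewrite inE hi // mem_itv.
have rel y : c3_rel G v y.
  by have /orbP[x /(subsetP KG)] := tr y; rewrite inE => /andP[_ vx] ->.
apply/subsetP=> x; rewrite Alt_even => xe; apply: (@even_on_c3 _ G setT) => //.
  move=> a b c _ _ _ ab bc ac.
  by apply: c3_rel_c3 => //; apply: c3_rel_trans (rel _); apply: c3_rel_sym.
by apply/subsetP=> a; rewrite inE.
Qed.

(* Tables of images. The generators act on the vertices of the hemi-icosahedron, the cube, the
   icosahedron and the 11-cell, respectively; [ord0] is the base vertex. *)
Definition hemiico : seq (seq nat) :=
 ([:: [:: 5; 4; 2; 3; 1; 0];
  [:: 0; 1; 4; 5; 2; 3];
  [:: 0; 4; 3; 2; 1; 5]])%N.
Definition cube : seq (seq nat) :=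
 ([:: [:: 1; 0; 3; 2; 5; 4; 7; 6];
  [:: 0; 2; 1; 3; 4; 6; 5; 7];
  [:: 0; 1; 4; 5; 2; 3; 6; 7]])%N.
Definition ico : seq (seq nat) :=
 ([:: [:: 1; 0; 2; 5; 4; 3; 8; 7; 6; 10; 9; 11];
  [:: 0; 2; 1; 4; 3; 5; 7; 6; 8; 9; 11; 10];
  [:: 0; 1; 7; 8; 11; 6; 5; 2; 3; 9; 10; 4]])%N.
Definition cell11 : seq (seq nat) :=
 ([:: [:: 9; 1; 8; 5; 4; 3; 6; 10; 2; 0; 7];
  [:: 0; 2; 1; 5; 7; 3; 9; 4; 8; 6; 10];
  [:: 0; 6; 8; 10; 4; 7; 1; 5; 2; 9; 3];
  [:: 0; 4; 7; 5; 1; 3; 6; 2; 10; 9; 8]])%N.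

Lemma hemiico_piece : piece setT (ord0 : 'I_6) 3 (tgens 5 hemiico).
Proof. apply: (@piece_okP 5 hemiico); by vm_compute. Qed.

Lemma cube_piece : piece setT (ord0 : 'I_8) 3 (tgens 7 cube).
Proof. apply: (@piece_okP 7 cube); by vm_compute. Qed.

Lemma ico_piece : piece setT (ord0 : 'I_12) 3 (tgens 11 ico).
Proof. apply: (@piece_okP 11 ico); by vm_compute. Qed.

Lemma cell11_piece : piece setT (ord0 : 'I_11) 4 (tgens 10 cell11).
Proof. apply: (@piece_okP 10 cell11); by vm_compute. Qed.

Lemma hemiico_odd i : i < 2 -> odd #[tgens 5 hemiico i * tgens 5 hemiico i.+1].
Proof.
(* The two products have orders 3 and 5, so the exponent 15 serves both. *)
by case: i => [|[|//]] _; apply: (@odd_order_tab _ _ _ _ _ 15) => //; vm_compute.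
Qed.

Lemma ico_odd i : i < 2 -> odd #[tgens 11 ico i * tgens 11 ico i.+1].
Proof.
by case: i => [|[|//]] _; apply: (@odd_order_tab _ _ _ _ _ 15) => //; vm_compute.
Qed.

Lemma cell11_odd i : i < 3 -> odd #[tgens 10 cell11 i * tgens 10 cell11 i.+1].
Proof.
by case: i => [|[|[|//]]] _; apply: (@odd_order_tab _ _ _ _ _ 15) => //; vm_compute.
Qed.

(* Found by computer search: in degree 12 the glued pieces have rank 5 and do not contract. *)
Definition deg12 : seq (seq nat) :=
 ([:: [:: 10; 2; 1; 5; 7; 3; 11; 4; 9; 8; 0; 6];
  [:: 1; 0; 3; 2; 9; 10; 8; 11; 6; 4; 5; 7];
  [:: 10; 7; 4; 11; 2; 6; 5; 1; 9; 8; 0; 3];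
  [:: 3; 2; 1; 0; 9; 10; 11; 8; 7; 4; 5; 6]])%N.

Lemma deg12_ok : all (tab_ok 11) deg12. Proof. by vm_compute. Qed.

Lemma deg12_str : stringC (tgens 11 deg12) 4.
Proof. by apply: (@str_okP 11 deg12 deg12_ok); vm_compute. Qed.

Lemma deg12_odd : odd #[tgens 11 deg12 2 * tgens 11 deg12 3].
Proof. by apply: (@odd_order_tab _ _ deg12_ok _ _ 3) => //; vm_compute. Qed.

Lemma word_c3 n ls (u : seq nat) (a b c : 'I_n.+1) : all (tab_ok n) ls ->
    all (fun k => k < size ls) u -> a != b -> b != c -> a != c ->
    tword n ls u = [seq if k == a :> nat then b : nat else if k == b :> nat then c : nat
                        else if k == c :> nat then a : nat else k | k <- iota 0 n.+1] ->
  \prod_(k <- u) tgens n ls k = c3 a b c.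
Proof.
move=> lok us ab bc ac uE; apply: rep_inj; rewrite rep_word // uE /rep -val_enum_ord -map_comp.
by apply: eq_map => x /=; rewrite c3E // -!val_eqE /=; do ?[case: ifP].
Qed.

Lemma deg12_realized : realized 4 (tgens 11 deg12).
Proof.
split; first exact: deg12_str.
apply/eqP; rewrite eqEsubset; apply/andP; split.
  apply: itv_sub => i _ i4; rewrite Alt_even odd_involution; last first.
    by apply/fperm2/tab_involutive; apply: nth_ok deg12_ok _ i4.
  (* Each generator is free of fixed points, thus a product of six transpositions. *)
  suff -> : [set x | tgens 11 deg12 i x != x] = setT by rewrite cardsT card_ord.
  apply/setP=> x; rewrite !inE -val_eqE /= tperm_ofE ?(nth_ok deg12_ok) //.
  suff /allP/(_ _ (ord_iota x)) :
    all (fun a => nth 0%N (nth [::] deg12 i) a != a) (iota 0 12) by [].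
  by case: i i4 => [|[|[|[|//]]]] _; vm_compute.
have G u a b c : all (fun k => k < 4) u -> \prod_(k <- u) tgens 11 deg12 k = c3 a b c ->
    c3 a b c \in itv_group (tgens 11 deg12) 0 4.
  move=> /allP u4 <-; rewrite big_seq; apply: group_prod => k ku.
  by apply: mem_itv; rewrite // u4.
apply: (@Alt_sub_c3 _ _ _ ord0) => [y|i i4].
  have h : all (fun a => a \in torb 11 deg12 4) (iota 0 12) by vm_compute.
  have [z zo yz] := torb_sound deg12_ok (leqnn 4) (allP h _ (ord_iota y)).
  by rewrite (val_inj yz).
(* The product of the four generators has cycle type 7, 3, 1, 1, so its seventh power is a 3-cycle.
   The conjugates used below link 0 to 1, 10 and 3, its images under the generators. *)
pose core := flatten (nseq 7 [:: 0; 1; 2; 3])%N.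
have tgE k a (h : a < 12) : k < 4 -> nth 0%N (nth [::] deg12 k) 0 = a ->
    tgens 11 deg12 k ord0 = Ordinal h.
  by move=> k4 ka; apply: val_inj; rewrite /= tperm_ofE ?ka // (nth_ok deg12_ok).
have c1 : c3 ord0 (@Ordinal 12 1%N isT) (@Ordinal 12 10 isT) \in itv_group (tgens 11 deg12) 0 4.
  by apply: (G ([:: 1; 2; 0] ++ core ++ [:: 0; 2; 1])%N) => //; apply: (word_c3 deg12_ok); vm_compute.
have c2 : c3 ord0 (@Ordinal 12 3 isT) (@Ordinal 12 5 isT) \in itv_group (tgens 11 deg12) 0 4.
  by apply: (G ([:: 2; 0; 1; 2; 1] ++ core ++ [:: 1; 2; 1; 0; 2])%N) => //; apply: (word_c3 deg12_ok); vm_compute.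
have [//|//|//|r1 _ r10] := c3_rel_mem _ _ _ c1.
have [//|//|//|r3 _ _] := c3_rel_mem _ _ _ c2.
case: i i4 => [|[|[|[|//]]]] _.
- by rewrite (@tgE 0 10 isT).
- by rewrite (@tgE 1%N 1%N isT).
- by rewrite (@tgE 2 10 isT).
- by rewrite (@tgE 3 3 isT).
Qed.

(** * Ladder pieces *)

Section Adjacent.
Variable s : nat.
Implicit Types (p : {perm 'I_s.+1}) (H : {group {perm 'I_s.+1}}).

Definition adj k : {perm 'I_s.+1} := tperm (inord k) (inord k.+1).

Lemma adj2 k : adj k * adj k = 1.
Proof. exact: tperm2. Qed.

Lemma adj_out k (x : 'I_s.+1) : k < s -> (x < k) || (k.+1 < x) -> adj k x = x.
Proof.
move=> ks h; apply: tpermD; apply: contraTneq h => <-; rewrite inordK; lia.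
Qed.

(** Adjacent transpositions give all others inside the window by conjugation, lengthening the
    distance by one each time; then [p] is peeled into transpositions. *)
Lemma adj_gen H i j p : j <= s ->
    (forall k, i <= k -> k < j -> adj k \in H) ->
    (forall x : 'I_s.+1, (x < i) || (j < x) -> p x = x) ->
  p \in H.
Proof.
move=> js hH.
have hT d (x y : 'I_s.+1) : i <= x -> y <= j -> y = x + d :> nat -> tperm x y \in H.
  elim: d x y => [|d IH] x y ix yj yxd.
    by rewrite (_ : y = x) ?tperm1 ?group1 //; apply: val_inj; rewrite /= yxd addn0.
  have ys := ltn_ord y; have zs : y.-1 < s.+1 by lia.
  have yE : y = inord y.-1.+1 by apply: val_inj; rewrite /= inordK; lia.
  have zE : Ordinal zs = inord y.-1 by apply: val_inj; rewrite /= inordK.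
  have [xz|xz] := eqVneq x (Ordinal zs).
    have -> : tperm x y = adj y.-1 by rewrite /adj xz -zE -yE.
    by apply: hH; lia.
  have -> : tperm x y = tperm x (Ordinal zs) ^ adj y.-1.
    rewrite tpermJ /adj -zE -yE tpermL tpermD // 1?eq_sym //.
    by rewrite -val_eqE /=; lia.
  by rewrite groupJ ?hH ?IH //=; lia.
have hT' (x y : 'I_s.+1) : (i <= x <= j) -> (i <= y <= j) -> tperm x y \in H.
  move=> xij yij; have [xy|xy] := leqP x y; first by apply: (hT (y - x)); lia.
  by rewrite tpermC; apply: (hT (x - y)); lia.
have [d] := ubnP #|[set x | p x != x]|; elim: d p => // d IH p pd hp.
have [a|p1] := pickP [pred x | p x != x]; last first.
  have -> : p = 1 by apply/permP=> x; rewrite perm1; apply/eqP/negbFE/p1.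
  exact: group1.
move=> /= pa.
have inij x : p x != x -> i <= x <= j by apply: contraR => h; apply/eqP/hp; lia.
have tH : tperm a (p a) \in H by rewrite hT' ?inij // (inj_eq perm_inj).
rewrite -(mulgK (tperm a (p a)) p) groupMr ?groupV //.
have pfix x : p x = x -> (p * tperm a (p a)) x = x.
  move=> px; rewrite permM px tpermD //; first by apply: contraNneq pa => ->; rewrite px.
  by apply: contraNneq pa => pax; rewrite -(inj_eq (@perm_inj _ p)) pax px.
apply: IH => [|x hx]; last exact/pfix/hp.
rewrite ltnS in pd; apply: leq_trans pd; apply: proper_card; apply/properP; split.
  by apply/subsetP=> x; rewrite !inE; apply: contraNN => /eqP/pfix ->.
by exists a; rewrite !inE // permM tpermR eqxx.
Qed.
End Adjacent.

(** * Signed permutations of columns *)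

Section Signed.
Variable C : finType.
Implicit Types (p : {perm C}) (f : C -> bool).

(** An element of the hyperoctahedral group: [p] permutes the columns, and the points of column [x]
    change sides on the way when [f x] holds. *)
Definition slad_fun p f (z : C * bool) : C * bool := (p z.1, z.2 (+) f z.1).

Lemma slad_funI p f : injective (slad_fun p f).
Proof.
move=> [x b] [y c] [/perm_inj -> /(congr1 (addb^~ (f y)))].
by rewrite !addbK => ->.
Qed.

Definition slad p f : {perm C * bool} := fperm (slad_fun p f).

Lemma sladE p f x b : slad p f (x, b) = (p x, b (+) f x).
Proof. by rewrite (fpermE (@slad_funI p f)). Qed.

Lemma eq_slad p f f' : f =1 f' -> slad p f = slad p f'.
Proof. by move=> ff; apply/permP=> -[x b]; rewrite !sladE ff. Qed.

Lemma sladM p p' f f' : slad p f * slad p' f' = slad (p * p') (fun x => f x (+) f' (p x)).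
Proof. by apply/permP=> -[x b]; rewrite permM !sladE permM addbA. Qed.

Lemma slad1 : slad 1 (fun=> false) = 1.
Proof. by apply/permP=> -[x b]; rewrite sladE !perm1 addbF. Qed.

Lemma slad_flip1 a : slad 1 (fun c => c == a) = tperm (a, true) (a, false).
Proof.
apply/permP=> -[x b]; rewrite sladE perm1; have [->|xa] := eqVneq x a.
  by case: b; rewrite ?tpermL ?tpermR.
by rewrite tpermD ?addbF // xpair_eqE eq_sym (negPf xa).
Qed.

(** Flips are removed two columns at a time. A single remaining flip is a transposition, which
    evenness rules out. *)
Lemma slad_flip_mem (H : {group {perm C * bool}}) (D : {set C}) f :
    (forall a b, a \in D -> b \in D -> a != b -> slad 1 (fun c => (c == a) || (c == b)) \in H) ->
    H \subset 'Alt_(C * bool)%type -> (forall c, f c -> c \in D) ->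
  ~~ odd_perm (slad 1 f) -> slad 1 f \in H.
Proof.
move=> HD HA; have [d] := ubnP #|[pred c | f c]|; elim: d f => // d IH f fd fD fe.
have [a /= fa|f0] := pickP [pred c | f c]; last first.
  by rewrite (eq_slad _ f0) slad1 group1.
have [b /= /andP[ba fb]|fU] := pickP [pred c | (c != a) && f c]; last first.
  case/negP: fe; rewrite (@eq_slad _ _ (fun c => c == a)) ?slad_flip1 ?odd_tperm ?xpair_eqE ?andbF //.
  by move=> c; have := fU c; rewrite /=; have [->|] //= := eqVneq c a; rewrite fa.
have abH : slad 1 (fun c => (c == a) || (c == b)) \in H by rewrite HD ?fD // eq_sym.
pose g c := [&& c != a, c != b & f c].
have fE : slad 1 f = slad 1 g * slad 1 (fun c => (c == a) || (c == b)).
  rewrite sladM mulg1; apply: eq_slad => c; rewrite perm1 /g.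
  have [->|ca] /= := eqVneq c a; first by rewrite fa.
  by have [->|cb] /= := eqVneq c b; rewrite ?fb ?addbF.
rewrite fE groupM //; apply: IH => [||].
- rewrite ltnS in fd; apply: leq_trans fd; apply: proper_card; apply/properP; split.
    by apply/subsetP=> c; rewrite !inE => /and3P[].
  by exists a; rewrite !inE /g ?eqxx.
- by move=> c /and3P[_ _ /fD].
- by move: fe; rewrite fE odd_permM; have := subsetP HA _ abH; rewrite Alt_even => /negPf ->; rewrite addbF.
Qed.
End Signed.

Section Ladder.
Variable s : nat.
Local Notation C := 'I_s.+1.
Implicit Types (p : {perm C}) (b e : bool).

(** The direct product of the symmetric group on the columns and the central flip of all columns at
    once. *)
Definition lad p e : {perm C * bool} := slad p (fun=> e).

Lemma ladE p e x b : lad p e (x, b) = (p x, b (+) e).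
Proof. exact: sladE. Qed.

Lemma ladM p p' e e' : lad p e * lad p' e' = lad (p * p') (e (+) e').
Proof. by apply/permP=> -[x b]; rewrite permM !ladE permM addbA. Qed.

Lemma lad_one : lad 1 false = 1.
Proof. by apply/permP=> -[x b]; rewrite ladE !perm1 addbF. Qed.

Lemma lad_inj p p' e e' : lad p e = lad p' e' -> p = p' /\ e = e'.
Proof.
move=> h; have E x := congr1 (fun u : {perm C * bool} => u (x, false)) h.
split; last by have := E ord0; rewrite !ladE => -[].
by apply/permP=> x; have := E x; rewrite !ladE => -[].
Qed.

Lemma odd_lad_pure x y : odd_perm (lad (tperm x y) false) = false.
Proof.
have -> : lad (tperm x y) false = tperm (x, true) (y, true) * tperm (x, false) (y, false).
  apply/permP=> -[z b]; rewrite permM ladE addbF.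
  have E (c : bool) : tperm (x, c) (y, c) (z, c) = (tperm x y z, c).
    by rewrite (inj_tperm _ _ _ (_ : injective (fun z : C => (z, c)))) // => ? ? [].
  case: b; first by rewrite E [RHS]tpermD // xpair_eqE andbF.
  by rewrite (tpermD (z := (z, false))) ?E // xpair_eqE andbF.
by rewrite odd_permM !odd_tperm !xpair_eqE !andbT addbb.
Qed.

Lemma odd_flip : odd_perm (lad 1 true) = odd s.+1.
Proof.
rewrite -[in RHS](card_ord s.+1).
apply: (odd_involution_imset (f := fun i : C => (i, true)) (g := fun i => (i, false))).
- by rewrite ladM mulg1 lad_one.
- by move=> ? ? [].
- by move=> ? ? [].
- by move=> i j; rewrite xpair_eqE andbF.
- by move=> i; rewrite ladE perm1.
- by move=> [i []] _; [left|right]; apply/codomP; exists i.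
Qed.

(* The Coxeter generators of the symmetric group on the columns, the first one twisted by the
   global sign change. *)
Definition lad0 i := lad (adj s i) (i == 0).

Lemma lad0_mem i j x : j <= s -> x \in itv lad0 i j ->
  exists p e, [/\ x = lad p e, 0 < i -> e = false &
    forall y : C, (y < i) || (j < y) -> p y = y].
Proof.
move=> js.
pose K := [set x : {perm C * bool} | [exists p : {perm C}, exists e : bool,
  [&& x == lad p e, (0 < i) ==> ~~ e & [forall y : C, ((y < i) || (j < y)) ==> (p y == y)]]]].
have KP z : reflect (exists p e, [/\ z = lad p e, 0 < i -> e = false &
    forall y : C, (y < i) || (j < y) -> p y = y]) (z \in K).
  rewrite inE; apply: (iffP existsP) => [[p /existsP[e /and3P[/eqP -> he hp]]]|[p [e [-> he hp]]]].
    exists p, e; split=> // [i0|y hy]; first by apply/negbTE/(implyP he).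
    by apply/eqP/(implyP (forallP hp y)).
  exists p; apply/existsP; exists e; rewrite eqxx /=; apply/andP; split.
    by apply/implyP=> i0; rewrite he.
  by apply/forallP=> y; apply/implyP=> hy; rewrite hp.
have gK : group_set K.
  apply/group_setP; split; first by apply/KP; exists 1, false; split; rewrite ?lad_one // => y; rewrite perm1.
  move=> x1 x2 /KP[p1 [e1 [-> he1 hp1]]] /KP[p2 [e2 [-> he2 hp2]]].
  apply/KP; exists (p1 * p2), (e1 (+) e2); split; first by rewrite ladM.
    by move=> i0; rewrite he1 // he2.
  by move=> y hy; rewrite permM hp1 // hp2.
move=> xq; apply/KP; apply: (subsetP (itv_sub (H := Group gK) _)) xq => k ik kj.
apply/KP; exists (adj s k), (k == 0); split=> // [i0|y hy]; first by lia.
by apply: adj_out; lia.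
Qed.

Lemma lad0_pure i j p : 0 < i -> j <= s ->
  (forall y : C, (y < i) || (j < y) -> p y = y) -> lad p false \in itv lad0 i j.
Proof.
move=> i0 js hp.
pose K := [set p : {perm C} | lad p false \in itv lad0 i j].
have gK : group_set K.
  apply/group_setP; split; first by rewrite inE lad_one group1.
  by move=> x y; rewrite !inE => hx hy; rewrite -(addbF false) -ladM groupM.
suff: p \in Group gK by rewrite inE.
apply: adj_gen hp => // k ik kj; rewrite inE.
have -> : lad (adj s k) false = lad0 k by rewrite /lad0 gtn_eqF // (leq_trans i0 ik).
exact: mem_itv.
Qed.

Lemma adj_cube k : k.+1 < s -> (adj s k * adj s k.+1) ^+ 3 = 1.
Proof.
move=> ks; rewrite /adj; set x := inord k; set y := inord k.+1; set z := inord k.+2.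
have xy : x != y by rewrite -val_eqE /= !inordK; lia.
have yz : y != z by rewrite -val_eqE /= !inordK; lia.
have xz : x != z by rewrite -val_eqE /= !inordK; lia.
have -> : tperm x y * tperm y z = c3 y x z by rewrite /c3 (tpermC x y).
have yx : y != x by rewrite eq_sym.
have : forall u, c3 y x z u = if u == y then x else if u == x then z else if u == z then y else u.
  by move=> u; apply: c3E.
move: (c3 y x z) => c E; apply/permP=> w; rewrite !expgS expg0 mulg1 !permM perm1.
have Ey : c y = x by rewrite E eqxx.
have Ex : c x = z by rewrite E eqxx (negPf xy).
have Ez : c z = y by rewrite E eqxx 2!(eq_sym z) (negPf xz) (negPf yz).
have [->|wy] := eqVneq w y; first by rewrite Ey Ex Ez.
have [->|wx] := eqVneq w x; first by rewrite Ex Ez Ey.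
have [->|wz] := eqVneq w z; first by rewrite Ez Ey Ex.
have cw : c w = w by rewrite E (negPf wy) (negPf wx) (negPf wz).
by rewrite !cw.
Qed.

Lemma ladX p e k : lad p e ^+ k = lad (p ^+ k) (odd k && e).
Proof.
elim: k => [|k IH]; first by rewrite !expg0 lad_one.
by rewrite !expgS IH ladM /=; congr lad; case: (odd k); rewrite ?addbb ?addbF.
Qed.

(** The cube of [lad0 0 * lad0 1] is the global flip: the 3-cycle of columns disappears and the
    sign, taken three times, stays. Hence the requirement [1 < j]; with the flip at hand, the twist
    can be undone. *)
Lemma lad0_all j p e : 1 < j -> j <= s ->
  (forall y : C, j < y -> p y = y) -> lad p e \in itv lad0 0 j.
Proof.
move=> j1 js hp.
have zq : lad 1 true \in itv lad0 0 j.
  have -> : lad 1 true = (lad0 0 * lad0 1%N) ^+ 3.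
    by rewrite /lad0 ladM ladX adj_cube //; lia.
  by rewrite groupX // groupM // mem_itv //; lia.
suff pq : lad p false \in itv lad0 0 j.
  by case: e => //; rewrite (_ : lad p true = lad p false * lad 1 true) ?groupM // ladM mulg1.
pose K := [set p : {perm C} | lad p false \in itv lad0 0 j].
have gK : group_set K.
  apply/group_setP; split; first by rewrite inE lad_one group1.
  by move=> x y; rewrite !inE => hx hy; rewrite -(addbF false) -ladM groupM.
suff: p \in Group gK by rewrite inE.
apply: (adj_gen (i := 0) (j := j)) => // k _ kj; rewrite inE.
case: k kj => [|k] kj; last exact: (@mem_itv _ lad0 0 j k.+1).
have -> : lad (adj s 0) false = lad0 0 * lad 1 true by rewrite ladM mulg1.
by rewrite groupM // mem_itv.
Qed.
End Ladder.

Section LadderString.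
Variable s : nat.
Local Notation C := 'I_s.+1.

Lemma adj_neq1 k : k < s -> adj s k != 1.
Proof.
move=> ks; apply/eqP=> /permP/(_ (inord k)); rewrite perm1 tpermL => /(congr1 val) /=.
by rewrite !inordK; lia.
Qed.

Lemma adj_commute i j : i.+1 < j -> j < s -> commute (adj s i) (adj s j).
Proof.
move=> ij js; apply/commgP/conjg_fixP; rewrite tpermJ.
by rewrite !adj_out ?inordK //; lia.
Qed.

Lemma odd_lad k e : k < s -> odd_perm (lad (adj s k) e) = e && ~~ odd s.
Proof.
move=> ks; have -> : lad (adj s k) e = lad (adj s k) false * lad 1 e by rewrite ladM mulg1.
rewrite odd_permM odd_lad_pure; case: e; first by rewrite odd_flip.
by rewrite lad_one odd_perm1.
Qed.

Lemma lad0_invol i : i < s -> lad0 s i != 1 /\ lad0 s i * lad0 s i = 1.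
Proof.
move=> js; split; last by rewrite ladM adj2 addbb lad_one.
by apply: contra_neq (adj_neq1 js); rewrite -lad_one => /lad_inj[].
Qed.

Lemma lad0_stringC : stringC (lad0 s) s.
Proof.
split; first exact: lad0_invol.
- by move=> i j ij js; rewrite /commute !ladM adj_commute // addbC.
move=> i j ij js; apply/subsetP=> x /setIP[xl xr].
have jE : j.-1 < j by lia.
have [p [e [xE he hp]]] := lad0_mem js xr.
have [p' [e' [+ _ hp']]] := lad0_mem (leq_trans (ltnW jE) js) xl.
rewrite xE => /lad_inj[pE _]; rewrite he //; apply: lad0_pure => //; first by apply: leq_trans js; apply: ltnW.
by move=> y /orP[yi|yj]; [rewrite hp ?yi | rewrite pE hp' ?yj ?orbT].
Qed.

Lemma odd_order_lad k e : k.+1 < s -> odd #[lad (adj s k) e * lad (adj s k.+1) e].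
Proof.
move=> ks; apply: (@dvdn_odd _ 3) => //.
by rewrite order_dvdn ladM addbb ladX adj_cube // andbF lad_one.
Qed.

Lemma lad0_odd_order i : 0 < i -> i.+1 < s -> odd #[lad0 s i * lad0 s i.+1].
Proof. by move=> i0 si; rewrite /lad0 gtn_eqF //=; apply: odd_order_lad. Qed.

Lemma lad0_col j x (y : C) b : j <= s -> x \in itv (lad0 s) 0 j -> j < y -> (x (y, b)).1 = y.
Proof.
move=> js /lad0_mem h jy; have [p [e [-> _ hp]]] := h js.
by rewrite ladE hp ?jy ?orbT.
Qed.

Hypotheses (s_odd : odd s) (s3 : 2 < s).

Lemma lad0_piece : piece setT (ord0 : C, true) s (lad0 s).
Proof.
split=> //; first by lia.
- exact: lad0_stringC.
- by move=> i _; apply/subsetP=> x; rewrite inE.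
- by move=> i si; rewrite odd_lad // s_odd andbF.
- by move=> i i0 si; rewrite ladE adj_out ?i0 // gtn_eqF.
- move=> j x j0 js xq xo.
  have [p [e [xE _ hp]]] := lad0_mem js xq; rewrite xE in xo *.
  have hj (y : C) b : j < y -> (p y, b (+) e) = (y, b).
    move=> jy; rewrite -ladE; apply: (out_perm xo).
    apply/orbP=> -[z zq zE]; have := lad0_col b (ltnW js) (groupVr zq) jy.
    by rewrite zE permK /= => y0; rewrite -y0 in jy.
  (* As [j < s], column [j.+1] exists; the orbit misses it, so no global flip can occur. *)
  have e0 : e = false by have := hj (inord j.+1) false; rewrite inordK // => /(_ (ltnSn j)) [].
  have {}hj (y : C) : j < y -> p y = y by move=> /(hj _ false)[].
  rewrite e0 in xo *; have [j1|j1] := ltnP 1 j; first exact: lad0_all (ltnW js) hj.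
  have {j1 j0} j1 : j = 1%N by apply/eqP; rewrite eqn_leq j1.
  suff -> : p = 1 by rewrite lad_one group1.
  apply/permP=> y; rewrite perm1.
  (* The orbit under [lad0 s 0] is (0, true), (1, false); the chosen point of each column lies
     outside it, so every column is fixed. *)
  suff : lad p false (y, y != ord0) = (y, y != ord0) by rewrite ladE => -[].
  apply: (out_perm xo); rewrite j1; apply/orbP=> -[z].
  have [] := lad0_invol (ltn_trans (isT : 0 < 2) s3) => _ q2.
  move=> /(itv_single q2)[]->; first by rewrite perm1 => -[->]; rewrite eqxx.
  have z0 : (ord0 : C) = inord 0 by apply: val_inj; rewrite /= inordK.
  rewrite ladE => -[->]; rewrite {1}z0 tpermL -val_eqE /= inordK //; lia.
- move=> [c b] _; apply/orbP; exists (lad (tperm ord0 c) (~~ b)).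
    by apply: lad0_all => // [|y sy]; [lia | have := ltn_ord y; lia].
  by rewrite ladE tpermL addTb negbK.
Qed.
End LadderString.

(** * Ladders with one more column *)

Section LadderOne.
Variable s : nat.
Local Notation C := 'I_s.+2.
Hypotheses (s_odd : odd s) (s3 : 2 < s).

Definition shift (z : 'I_s.+1 * bool) : C * bool := (lift ord0 z.1, z.2).

Lemma shift_inj : injective shift.
Proof.
move=> [x b] [y c] e; have := congr1 snd e; have := congr1 fst e.
by move=> /= /lift_inj -> ->.
Qed.

(* [lad0] acting on all columns but the first, preceded by the transposition of the first two
   columns, see [lad1S]. *)
Definition lad1 i := slad (adj s.+1 i) (fun c => (i == 1%N) && (c != ord0)).

Lemma push_lad p e :
  push shift_inj (lad p e) = slad (lift_perm ord0 ord0 p) (fun c => e && (c != ord0)).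
Proof.
apply/permP=> -[x b]; rewrite sladE; case: (unliftP ord0 x) => [y ->|->].
  by rewrite (pushE shift_inj _ (y, b)) ladE lift_perm_lift /shift /= andbT.
rewrite push_out ?lift_perm_id ?andbF ?addbF //.
by apply/codomP=> -[[y c]] [].
Qed.

Lemma adjS k : k < s -> lift_perm ord0 ord0 (adj s k) = adj s.+1 k.+1.
Proof.
move=> ks; have inordS m : m < s.+1 -> inord m.+1 = lift ord0 (inord m : 'I_s.+1) :> C.
  by move=> ms; apply: val_inj; rewrite /= /bump /= !inordK.
apply/permP=> x; rewrite /adj !inordS ?ltnS ?(ltnW ks) //.
case: (unliftP ord0 x) => [y ->|->]; first by rewrite lift_perm_lift inj_tperm //; apply: lift_inj.
by rewrite lift_perm_id tpermD.
Qed.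

Lemma lad1S k : k < s -> lad1 k.+1 = push shift_inj (lad0 s k).
Proof. by move=> ks; rewrite /lad1 push_lad adjS. Qed.

Lemma lad1_0 : lad1 0 = lad (adj s.+1 0) false.
Proof. by apply/permP=> -[x b]; rewrite !sladE. Qed.

Lemma itv_lad1 i j : j <= s -> itv lad1 i.+1 j.+1 = push_morphism shift_inj @* itv (lad0 s) i j.
Proof.
move=> js; rewrite -itv_morphim; apply/eqP; rewrite eqEsubset; apply/andP; split.
  apply: itv_sub => -[//|k] h1 h2; rewrite lad1S; last by apply: leq_trans js.
  exact: (@mem_itv _ (push_morphism shift_inj \o lad0 s)).
by apply: itv_sub => k h1 h2 /=; rewrite -lad1S ?(leq_trans h2) // mem_itv.
Qed.

Lemma lad1_mem j x : j <= s.+1 -> x \in itv lad1 0 j ->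
  exists p f, x = slad p f /\ forall y : C, j < y -> p y = y.
Proof.
move=> js.
pose K := [set x : {perm C * bool} | [exists p : {perm C}, exists f : {ffun C -> bool},
  (x == slad p f) && [forall y : C, (j < y) ==> (p y == y)]]].
have KP z : reflect (exists p (f : C -> bool), z = slad p f /\
    forall y : C, (j < y) -> p y = y) (z \in K).
  rewrite inE; apply: (iffP existsP) => [[p /existsP[f /andP[/eqP -> hp]]]|[p [f [-> hp]]]].
    by exists p, f; split=> // y hy; apply/eqP/(implyP (forallP hp y)).
  exists p; apply/existsP; exists (finfun f); apply/andP; split.
    by apply/eqP/eq_slad=> y; rewrite ffunE.
  by apply/forallP=> y; apply/implyP=> hy; rewrite hp.
have gK : group_set K.
  apply/group_setP; split.
    by apply/KP; exists 1, (fun=> false); split; rewrite ?slad1 // => y; rewrite perm1.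
  move=> x1 x2 /KP[p1 [f1 [-> hp1]]] /KP[p2 [f2 [-> hp2]]].
  apply/KP; exists (p1 * p2), (fun x => f1 x (+) f2 (p1 x)); split; first by rewrite sladM.
  by move=> y hy; rewrite permM hp1 // hp2.
move=> xq; apply/KP; apply: (subsetP (itv_sub (H := Group gK) _)) xq => k _ kj.
apply/KP; exists (adj s.+1 k), (fun c => (k == 1%N) && (c != ord0)); split=> // y hy.
by apply: adj_out; lia.
Qed.

Lemma lad1_even i : i < s.+1 -> ~~ odd_perm (lad1 i).
Proof.
case: i => [|i] si; first by rewrite lad1_0 odd_lad.
by rewrite lad1S // odd_push odd_lad // s_odd andbF.
Qed.

Lemma lad1_invol i : i < s.+1 -> lad1 i != 1 /\ lad1 i * lad1 i = 1.
Proof.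
case: i => [|i] si.
  rewrite lad1_0 ladM adj2 addbb lad_one; split=> //.
  by apply: contra_neq (adj_neq1 si); rewrite -lad_one => /lad_inj[].
rewrite lad1S //; have [n1 n2] := @lad0_invol s i si; split; last by rewrite -pushM n2 (morph1 (push_morphism shift_inj)).
by apply: contra_neq n1; rewrite -(morph1 (push_morphism shift_inj)) => /push_inj.
Qed.

Lemma lad1_pure i : i != 1%N -> lad1 i = lad (adj s.+1 i) false.
Proof. by move=> /negPf i1; apply: eq_slad => c; rewrite i1. Qed.

(** The only twisted generator is [lad1 1]; its untwisted version lies in the image of the smaller
    ladder, whose global flip is available because [2 < j]. *)
Lemma lad1_pure_mem j (p : {perm C}) : 2 < j -> j <= s.+1 -> (forall y : C, j < y -> p y = y) ->
  lad p false \in itv lad1 0 j.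
Proof.
move=> j3 js hp; pose K := [set p : {perm C} | lad p false \in itv lad1 0 j].
have gK : group_set K.
  apply/group_setP; split; first by rewrite inE lad_one group1.
  by move=> x y; rewrite !inE => hx hy; rewrite -(addbF false) -ladM groupM.
suff: p \in Group gK by rewrite inE.
apply: (adj_gen (i := 0) (j := j)) => // k _ kj; rewrite inE.
have [k1|k1] := eqVneq k 1%N; last by rewrite -lad1_pure // mem_itv.
have -> : lad (adj s.+1 k) false = push shift_inj (lad (adj s 0) false).
  by rewrite push_lad adjS ?k1 //; lia.
have j1 : j.-1 <= s by lia.
have jE : j = j.-1.+1 by lia.
apply: (subsetP (itvS lad1 (leqnSn 0) (leqnn j))); rewrite {1}jE itv_lad1 //.
apply: mem_morphim; rewrite ?inE //; apply: lad0_all => // [|y jy]; first by lia.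
by rewrite adj_out //; lia.
Qed.

(* Products of two such elements are the sign changes of pairs of columns. *)
Lemma lad1_nflip_mem j a : 2 < j -> j <= s.+1 -> a <= j ->
  slad 1 (fun c : C => c != inord a) \in itv lad1 0 j.
Proof.
move=> j3 js aj.
have -> : slad 1 (fun c : C => c != inord a) = lad (tperm ord0 (inord a)) false *
    push shift_inj (lad 1 true) * lad (tperm ord0 (inord a)) false.
  rewrite push_lad lift_perm1 !sladM mulg1 tperm2; apply: eq_slad => c.
  by rewrite !addbF /= (canF_eq (tpermK _ _)) tpermL.
have tj : lad (tperm (ord0 : C) (inord a)) false \in itv lad1 0 j.
  apply: lad1_pure_mem => // y jy; apply: tpermD.
    by rewrite -val_eqE /=; lia.
  by rewrite -val_eqE /= inordK; lia.
rewrite !groupM //.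
have j1 : j.-1 <= s by lia.
have jE : j = j.-1.+1 by lia.
apply: (subsetP (itvS lad1 (leqnSn 0) (leqnn j))); rewrite {1}jE itv_lad1 //.
apply: mem_morphim; rewrite ?inE //; apply: lad0_all => // [|y jy]; first by lia.
by rewrite perm1.
Qed.

(* Invariant under the first two generators, and disjoint from its image under the global sign
   change; this settles the low ranks, where there are no free sign changes yet. *)
Let W : {set C * bool} := [set (ord0, true); (inord 1, true); (inord 2, false)].

Lemma lad1_W x z : x \in itv lad1 0 2 -> z \in W -> x z \in W.
Proof.
move=> xq zW; have xW : x \in 'N(W | 'P).
  apply: (subsetP (itv_sub _)) xq => -[|[|//]] _ _; rewrite !inE.
    apply/subsetP=> -[c b]; rewrite !inE /= /aperm sladE /= addbF !xpair_eqE.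
    have -> : (ord0 : C) = inord 0 by apply: val_inj; rewrite /= inordK.
    case: b; rewrite ?andbT ?andbF ?orbF /=.
      by case/orP=> /eqP->; rewrite ?tpermL ?tpermR eqxx ?orbT.
    move=> /eqP->; rewrite tpermD ?eqxx ?orbT //; rewrite -val_eqE /= !inordK //; lia.
  apply/subsetP=> -[c b]; rewrite !inE /= /aperm sladE /= !xpair_eqE.
  have i10 : (inord 1 : C) != ord0 by rewrite -val_eqE /= inordK.
  have i20 : (inord 2 : C) != ord0 by rewrite -val_eqE /= inordK //; lia.
  case: b; rewrite ?andbT ?andbF ?orbF /=.
    case/orP=> /eqP->; last by rewrite i10 tpermL !eqxx ?orbT.
    by rewrite eqxx tpermD //= ?eqxx.
  by move=> /eqP->; rewrite i20 tpermR !eqxx ?orbT.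
by rewrite -[x z]apermE (astabs_act z xW).
Qed.

Lemma lad1_commute i j : i.+1 < j -> j < s.+1 -> commute (lad1 i) (lad1 j).
Proof.
move=> ij js; rewrite /commute !sladM adj_commute //; apply: eq_slad => c.
rewrite (gtn_eqF (leq_trans _ ij)) //= addbF; congr (_ && ~~ _).
rewrite -(inj_eq (@perm_inj _ (adj s.+1 j))) (adj_out js (x := ord0)) //=; lia.
Qed.

(** By the first membership [x] fixes the later columns, and by the second it comes from [lad0]. For
    large [j] this suffices by [lad0_all]. For [j = 0], [x] must fix the first column; for [j = 1],
    invariance of [W] couples the flip to the column swap and leaves only 1 and the twisted
    generator. *)
Lemma lad1_ip0 j x : j < s -> x \in itv lad1 0 j.+1 -> x \in itv lad1 1 j.+2 ->
  x \in itv lad1 1 j.+1.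
Proof.
move=> js xl; rewrite !itv_lad1 ?(ltnW js) // => /morphimP[y _ yq xE].
have [p [e [yE _ hp]]] := lad0_mem js yq.
have {}hp (c : 'I_s.+1) : j < c -> p c = c.
  have [p' [f [xE' hp']]] := lad1_mem (leqW js) xl.
  move=> jc; have := congr1 (fun u : {perm C * bool} => u (shift (c, false))) xE'.
  rewrite {1}xE /= pushE yE ladE sladE hp' // => /(congr1 fst) /= /lift_inj -> //.
have mem_y : y \in itv (lad0 s) 0 j -> x \in push_morphism shift_inj @* itv (lad0 s) 0 j.
  by move=> yj; rewrite xE mem_morphim ?inE.
apply: mem_y; rewrite yE; have [j1|j1] := ltnP 1 j; first exact: lad0_all (ltnW js) hp.
case: j j1 js xl hp {yq} => [|[|//]] _ js xl hp.
  have [] := itv_single (lad1_invol (ltn0Sn s)).2 xl => xE'.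
    suff -> : lad p e = 1 by rewrite group1.
    rewrite -yE; apply: (push_inj (h_inj := shift_inj)).
    by rewrite (morph1 (push_morphism shift_inj)) -[1]xE' xE.
  have := congr1 (fun u : {perm C * bool} => u (ord0, false)) xE'.
  have z0 : (ord0 : C) = inord 0 by apply: val_inj; rewrite /= inordK.
  rewrite {1}xE /= yE push_lad !sladE lift_perm_id /adj -z0 tpermL => /(congr1 (fun z => val z.1)) /=.
  by rewrite inordK.
have l1 : lift ord0 (ord0 : 'I_s.+1) = inord 1 :> C by apply: val_inj; rewrite /= inordK.
have := lad1_W (z := (inord 1, true)) xl; rewrite !inE eqxx orbT => /(_ isT).
rewrite xE /= yE -l1 (pushE shift_inj (lad p e) (ord0, true)) ladE /shift /= !xpair_eqE.
rewrite (inj_eq lift_inj).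
case/orP=> /andP[/eqP p0 /eqP e0].
  have -> : p = 1.
    apply/permP=> c; rewrite perm1; have [c1|c1] := ltnP 1 c; first exact: hp.
    have [c0|c0] := eqVneq c ord0; first by rewrite c0.
    have [pc|pc] := ltnP 1 (p c); first by apply: (@perm_inj _ p); rewrite hp.
    apply: val_inj; have : p c != ord0 by rewrite -[X in _ != X]p0 (inj_eq perm_inj).
    by move: c0; rewrite -!val_eqE /=; lia.
  by case: e e0 {yE} => // _; rewrite lad_one group1.
have p01 : p ord0 = inord 1.
  by apply: (@lift_inj _ ord0); rewrite p0; apply: val_inj; rewrite /= /bump /= !inordK //; lia.
have -> : lad p e = lad0 s 0.
  rewrite /lad0; case: e e0 {yE} => // _; congr lad; apply/permP=> c.
  have z0 : (ord0 : 'I_s.+1) = inord 0 by apply: val_inj; rewrite /= inordK.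
  rewrite /adj -z0; case: tpermP => [->//|->|].
    apply: val_inj => /=.
    have : p (inord 1) != inord 1 by rewrite -[X in _ != X]p01 (inj_eq perm_inj) -val_eqE /= inordK //; lia.
    have [pc|pc] := ltnP 1 (p (inord 1)); last by rewrite -val_eqE /= inordK; lia.
    by have /perm_inj := hp _ pc => e1; rewrite e1 inordK // in pc; lia.
  move=> c0 c1; apply: hp; move/eqP: c0; move/eqP: c1; rewrite -!val_eqE /= inordK; lia.
exact: mem_itv.
Qed.

Lemma lad1_stringC : stringC lad1 s.+1.
Proof.
split; [exact: lad1_invol | exact: lad1_commute |].
move=> [|i] [//|[|j]] // ij js; apply/subsetP=> x /setIP[xl xr].
  exact: lad1_ip0.
have [js1 js2] : j.+1 <= s /\ j <= s by split; lia.
move: xl xr; rewrite /= !itv_lad1 // -!itv_morphim => xl xr.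
have [_ _ ip] := stringC_morphim (push_injm shift_inj) (lad0_stringC s).
by apply: (subsetP (ip i j.+1 ij js1)); rewrite inE xl.
Qed.

Lemma lad1_col j x (y : C) b : j <= s.+1 -> x \in itv lad1 0 j -> j < y -> (x (y, b)).1 = y.
Proof.
move=> js /lad1_mem h jy; have [p [f [-> hp]]] := h js.
by rewrite sladE hp.
Qed.

Lemma lad1_odd_order i : 1 < i -> i < s -> odd #[lad1 i * lad1 i.+1].
Proof.
move=> i1 si; rewrite !lad1_pure ?odd_order_lad //; first by lia.
by rewrite gtn_eqF.
Qed.

Lemma lad1_piece : piece setT (ord0 : C, true) s.+1 lad1.
Proof.
have vW : (ord0, true) \in W by rewrite !inE eqxx.
split=> //.
- exact: lad1_stringC.
- by move=> i _; apply/subsetP=> x; rewrite inE.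
- exact: lad1_even.
- by move=> i i0 si; rewrite sladE eqxx andbF adj_out ?i0.
- move=> j x j0 js xq xo.
  have [p [f [xE hp]]] := lad1_mem js xq.
  have [j3|j3] := ltnP 2 j; last first.
    (* For [j <= 2] the orbit stays in [W], which contains at most one point of each column. A
       signed permutation fixing a point in every column is trivial. *)
    suff -> : x = 1 by rewrite group1.
    apply/permP=> -[c b].
    have /(out_perm xo) : (c, c == inord 2) \notin orb (itv lad1 0 j) (ord0, true).
      apply/orbP=> -[z zq zE]; have : (c, c == inord 2) \in W.
        by rewrite zE lad1_W // (subsetP (itvS _ (leqnn 0) j3)).
      have i20 : (inord 2 : C) != ord0 by rewrite -val_eqE /= inordK //; lia.
      have i21 : (inord 2 : C) != inord 1 by rewrite -val_eqE /= !inordK //; lia.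
      rewrite !inE !xpair_eqE; have [->|c2] := eqVneq c (inord 2).
        by rewrite (negPf i20) (negPf i21).
      by rewrite !andbF.
    by rewrite xE !sladE perm1 => -[-> /(canRL (addKb _))]; rewrite addbb => ->; rewrite addbF.
  have hj (c : C) b : j < c -> x (c, b) = (c, b).
    move=> jc; apply: (out_perm xo).
    apply/orbP=> -[z zq zE]; have := lad1_col b (ltnW js) (groupVr zq) jc.
    by rewrite zE permK /= => c0; rewrite -c0 in jc.
  have {}hp (c : C) : j < c -> p c = c by move=> /(hj _ false); rewrite xE sladE => -[].
  have hf (c : C) : f c -> c <= j.
    by move=> fc; rewrite leqNgt; apply/negP=> /(hj _ false); rewrite xE sladE fc => -[].
  (* Once the column permutation is split off, what remains is an even set of flips of columns up to
     [j], a product of flips of pairs. *)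
  have xM : x = slad 1 f * lad p false.
    by rewrite sladM mul1g xE; apply: eq_slad => c; rewrite addbF.
  have HA k : k <= s.+1 -> itv lad1 0 k \subset 'Alt_(C * bool)%type.
    by move=> ks; apply: itv_sub => i _ ik; rewrite Alt_even lad1_even // (leq_trans ik).
  have pj : lad p false \in itv lad1 0 j by apply: lad1_pure_mem => //; apply: ltnW.
  rewrite xM groupM //; apply: (slad_flip_mem (D := [set c : C | c <= j])).
  + move=> a b; rewrite !inE => aj bj ab.
    have -> : slad 1 (fun c : C => (c == a) || (c == b)) =
       slad 1 (fun c : C => c != inord a) * slad 1 (fun c : C => c != inord b).
      rewrite sladM mulg1; apply: eq_slad => c; rewrite perm1 !inord_val.
      by have [->|ca] := eqVneq c a; rewrite ?(negPf ab) //; case: eqVneq.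
    by rewrite groupM // lad1_nflip_mem // ltnW.
  + exact/HA/ltnW.
  + by move=> c /hf; rewrite inE.
  have := subsetP (HA _ js) _ xq; rewrite Alt_even xM odd_permM.
  by have := subsetP (HA _ (ltnW js)) _ pj; rewrite Alt_even => /negPf->; rewrite addbF.
- move=> [c b] _.
  have s2 : 2 < s.+1 by apply: ltnW.
  have tq : lad (tperm ord0 c) false \in itv lad1 0 s.+1.
    by apply: lad1_pure_mem => // y sy; have := ltn_ord y; lia.
  pose a := if c == ord0 then 1%N else 0.
  have fq : slad 1 (fun d : C => d != inord a) \in itv lad1 0 s.+1.
    by apply: lad1_nflip_mem => //; rewrite /a; case: ifP.
  have ca : c != inord a.
    rewrite /a; have [->|c0] := eqVneq c ord0; rewrite -val_eqE /= inordK //.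
  apply/orbP; case: b; first by exists (lad (tperm ord0 c) false); rewrite // ladE tpermL.
  exists (lad (tperm ord0 c) false * slad 1 (fun d : C => d != inord a)); first exact: groupM.
  by rewrite permM ladE tpermL sladE perm1 ca.
Qed.
End LadderOne.

(** * The family for degree 1 modulo 4 *)

Section CappedLadder.
Variable s : nat.
Local Notation C := 'I_s.+1.
Local Notation X := (option (C * bool)).

Lemma Some_injective : injective (@Some (C * bool)).
Proof. by move=> x y []. Qed.
Local Notation pushS := (push Some_injective).

(* [Some (c, b)] is the point of column [c] on side [b], and [None] an extra point attached to
   the first column. *)
Definition clad i : {perm X} :=
  if i is k.+1 then pushS (lad (adj s k) false)
  else tperm (Some (ord0, true)) None * pushS (slad 1 (fun c => c != ord0)).

Lemma clad0_None : clad 0 None = Some (ord0, true).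
Proof. by rewrite permM tpermR pushE sladE perm1. Qed.

Lemma clad0_cap : clad 0 (Some (ord0, true)) = None.
Proof. by rewrite permM tpermL push_out //; apply/codomP=> -[]. Qed.

Lemma clad0E c b : (c, b) != (ord0, true) -> clad 0 (Some (c, b)) = Some (c, b (+) (c != ord0)).
Proof. by move=> cb; rewrite permM tpermD ?pushE ?sladE ?perm1 // eq_sym. Qed.

Lemma clad0_flip c b : c != ord0 -> clad 0 (Some (c, b)) = Some (c, ~~ b).
Proof. by move=> c0; rewrite clad0E ?xpair_eqE ?(negPf c0) //= addbT. Qed.

Lemma cladS_None k : clad k.+1 None = None.
Proof. by rewrite push_out //; apply/codomP=> -[]. Qed.

Lemma cladSE k c b : clad k.+1 (Some (c, b)) = Some (adj s k c, b).
Proof. by rewrite pushE ladE addbF. Qed.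

Lemma push_lad_morphic : {morph (fun p : {perm C} => pushS (lad p false)) : x y / x * y}.
Proof. by move=> p p'; rewrite -pushM ladM. Qed.
Canonical push_lad_morphism := @Morphism _ _ [set: {perm C}] _ (in2W push_lad_morphic).

Lemma push_lad_injm : 'injm push_lad_morphism.
Proof. by apply/injmP=> p p' _ _ /push_inj/lad_inj[]. Qed.

Lemma itv_clad i j : itv clad i.+1 j.+1 = push_lad_morphism @* itv (adj s) i j.
Proof.
rewrite -itv_morphim; apply/eqP; rewrite eqEsubset; apply/andP; split.
  by apply: itv_sub => -[//|k] h1 h2; apply: (@mem_itv _ (push_lad_morphism \o adj s)).
by apply: itv_sub => k h1 h2; apply: (@mem_itv _ clad _ _ k.+1).
Qed.

Lemma itv_adjP i j (p : {perm C}) : j <= s ->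
  reflect (forall y : C, (y < i) || (j < y) -> p y = y) (p \in itv (adj s) i j).
Proof.
move=> js; apply: (iffP idP) => [pq|]; last first.
  by apply: adj_gen => // k ik kj; apply: mem_itv.
pose K := [set c : C | (i <= c) && (c <= j)].
have pK : perm_on K p.
  rewrite -SymonE; apply: (subsetP (itv_sub _)) pq => k ik kj; rewrite SymonE.
  apply/subsetP=> y; rewrite !inE; apply: contraR => h; rewrite adj_out //; lia.
by move=> y hy; apply: (out_perm pK); rewrite inE; lia.
Qed.

Lemma adj_stringC : stringC (adj s) s.
Proof.
split; [by move=> i si; rewrite adj_neq1 // adj2 | exact: adj_commute |].
move=> i j ij js; have [j1 j2] : j.-1 < j /\ j.-1 <= s by split; lia.
apply/subsetP=> x /setIP[/(itv_adjP _ _ j2) xl /(itv_adjP _ _ js) xr].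
by apply/itv_adjP=> // y /orP[yi|yj]; [apply: xr; rewrite yi | apply: xl; rewrite yj orbT].
Qed.

Hypotheses (s_odd : odd s) (s3 : 2 < s).

Lemma clad0_sq : clad 0 * clad 0 = 1.
Proof.
apply/permP=> -[[c b]|]; rewrite permM perm1; last by rewrite clad0_None clad0_cap.
have [[-> ->]|cb] := eqVneq (c, b) (ord0, true); first by rewrite clad0_cap clad0_None.
rewrite clad0E // clad0E ?addbK //; move: cb; rewrite !xpair_eqE; case: eqP => //= _.
by rewrite addbF.
Qed.

Lemma clad_invol i : i < s.+1 -> clad i != 1 /\ clad i * clad i = 1.
Proof.
case: i => [_|i si].
  split; last exact: clad0_sq.
  by apply/eqP=> /permP/(_ None); rewrite clad0_None perm1.
by have [inv _ _] := stringC_morphim push_lad_injm adj_stringC; apply: inv.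
Qed.

(** The first generator only flips the later columns, and the others in the window do not reach [c].
    In [clad_stringC] this bounds the columns moved by an element of both windows. *)
Lemma clad_col j x (c : C) b : 0 < j -> j <= s -> x \in itv clad 0 j -> j <= c ->
  exists b', x (Some (c, b)) = Some (c, b').
Proof.
move=> j0 js xq jc.
suff : x (Some (c, b)) \in [set Some (c, true); Some (c, false)].
  by rewrite !inE => /orP[]/eqP->; [exists true | exists false].
have xN : x \in 'N([set Some (c, true); Some (c, false)] | 'P).
  apply: (subsetP (itv_sub _)) xq => k _ kj; rewrite !inE; apply/subsetP=> y.
  have c0 : c != ord0 by rewrite -val_eqE /=; lia.
  have kE : exists b0, forall b, clad k (Some (c, b)) = Some (c, b (+) b0).
    case: k kj => [|k] kj; first by exists true => b0; rewrite clad0_flip // addbT.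
    exists false => b0; rewrite cladSE addbF adj_out //; lia.
  have [b0 {}kE] := kE.
  by rewrite !inE /= /aperm => /orP[]/eqP->; rewrite kE; case: b0 {kE}; rewrite /= eqxx ?orbT.
by rewrite -[x _]apermE (astabs_act _ xN); case: b; rewrite !inE eqxx ?orbT.
Qed.

Lemma clad_stringC : stringC clad s.+1.
Proof.
have [_ com ip] := stringC_morphim push_lad_injm adj_stringC.
split; first exact: clad_invol.
  move=> [|i] [|j] // ij js; last exact: (com i j).
  apply/permP=> -[[c b]|]; rewrite (permM (clad 0)) (permM (clad j.+1)); last first.
    rewrite cladS_None clad0_None cladSE adj_out //=; lia.
  have a0 : adj s j ord0 = ord0 by rewrite adj_out //=; lia.
  have [[-> ->]|cb] := eqVneq (c, b) (ord0, true).
    by rewrite clad0_cap cladS_None cladSE a0 clad0_cap.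
  have ac : (adj s j c == ord0) = (c == ord0) by rewrite -[in LHS]a0 (inj_eq perm_inj).
  by rewrite clad0E // !cladSE clad0E ?ac // xpair_eqE ac.
move=> [|i] [//|[|j]] // ij js; apply/subsetP=> x /setIP[xl]; last first.
  move: xl; rewrite /= !itv_clad -!itv_morphim => xl xr.
  by apply: (subsetP (ip i j.+1 ij js)); rewrite inE xl.
rewrite /= !itv_clad => /morphimP[p _ /itv_adjP hp xE].
rewrite xE; apply: mem_morphim; rewrite ?inE //; apply/itv_adjP => [|y]; first by lia.
rewrite ltn0 /= => jy; have js' : j.+1 <= s by [].
have [b'] := clad_col false (ltn0Sn j) js' xl jy.
by rewrite xE /= pushE ladE => -[].
Qed.

Lemma clad_odd_order i : i.+2 < s -> odd #[clad i.+2 * clad i.+3].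
Proof.
move=> si; rewrite -push_lad_morphic (order_injm push_lad_injm) ?inE //.
apply: (@dvdn_odd _ 3) => //.
by rewrite order_dvdn adj_cube // ltnW.
Qed.

(** In [clad 0], the flips of the [s] columns other than the first form an odd permutation, balanced
    by the transposition with the extra point. *)
Lemma clad_even i : i < s.+1 -> ~~ odd_perm (clad i).
Proof.
case: i => [_|i si]; last by rewrite /clad odd_push odd_lad.
rewrite /clad odd_permM odd_tperm odd_push /=.
have := odd_flip s; rewrite oddS s_odd /=.
have -> : lad 1 true = slad 1 (fun c : C => c != ord0) * slad 1 (fun c : C => c == ord0).
  by rewrite sladM mulg1; apply: eq_slad => c; rewrite perm1; case: eqP.
by rewrite odd_permM slad_flip1 odd_tperm xpair_eqE andbF /= addbT => /negbFE->.
Qed.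

Lemma clad_tr y : y \in orb (itv clad 0 s.+1) (Some (ord0, false)).
Proof.
have tq c b : Some (ord0, b) \in orb (itv clad 0 s.+1) (Some (ord0, false)) ->
    Some (c, b) \in orb (itv clad 0 s.+1) (Some (ord0, false)).
  have -> : Some (c, b) = push_lad_morphism (tperm ord0 c) (Some (ord0, b)).
    by rewrite /= pushE ladE addbF tpermL.
  apply: orb_stable; apply: (subsetP (itvS _ (leqnSn 0) (leqnn _))); rewrite itv_clad.
  apply: mem_morphim; rewrite ?inE //; apply/itv_adjP=> // z.
  by have := ltn_ord z; lia.
have q0 : clad 0 \in itv clad 0 s.+1 by apply: mem_itv.
have f0 := tq _ _ (orb_refl _ _).
have t0 : Some (ord0, true) \in orb (itv clad 0 s.+1) (Some (ord0, false)).
  have i1 : (inord 1 : C) != ord0 by rewrite -val_eqE /= inordK //; lia.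
  have := orb_stable q0 (f0 (inord 1)); rewrite clad0_flip //= => h.
  have -> : Some (ord0, true) = push_lad_morphism (tperm ord0 (inord 1)) (Some (inord 1, true)).
    by rewrite /= pushE ladE addbF tpermR.
  apply: orb_stable h; apply: (subsetP (itvS _ (leqnSn 0) (leqnn _))); rewrite itv_clad.
  apply: mem_morphim; rewrite ?inE //; apply/itv_adjP=> // z.
  by have := ltn_ord z; lia.
case: y => [[c []]|]; [exact: tq | exact: f0 |].
by rewrite -clad0_cap; apply: orb_stable.
Qed.

(** The first five factors of [h] exchange [None] with (2, false) and (0, false) with (2, true), and
    [clad 1] swaps columns 0 and 1. So [h] is a 3-cycle times two disjoint transpositions, which
    squaring removes. *)
Lemma clad_c3 :
  let h := clad 0 * clad 1 * clad 2 * clad 1 * clad 0 * clad 1 in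
  h * h = c3 (Some (ord0, false)) (Some (inord 1, false)) (Some (inord 2, true)).
Proof.
move=> h; rewrite {}/h.
have z0 : (ord0 : C) = inord 0 by apply: val_inj; rewrite /= inordK.
have i10 : (inord 1 : C) == ord0 = false by rewrite -val_eqE /= inordK //; lia.
have i20 : (inord 2 : C) == ord0 = false by rewrite -val_eqE /= inordK //; lia.
have i21 : (inord 2 : C) == inord 1 = false by rewrite -val_eqE /= !inordK //; lia.
have E1 (c : C) b : clad 1 (Some (c, b)) = Some (if c == ord0 then inord 1 else if c == inord 1 then ord0 else c, b).
  rewrite cladSE /adj -z0; case: tpermP => [->|->|/eqP/negPf-> /eqP/negPf->] //.
  by rewrite i10 eqxx.
have E2 (c : C) b : clad 2 (Some (c, b)) = Some (if c == inord 1 then inord 2 else if c == inord 2 then inord 1 else c, b).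
  rewrite cladSE /adj; case: tpermP => [->|->|/eqP/negPf-> /eqP/negPf->] //; first by rewrite eqxx.
  by rewrite i21 eqxx.
have E0 (c : C) b : clad 0 (Some (c, b)) =
    if c == ord0 then if b then None else Some (c, b) else Some (c, ~~ b).
  have [->|c0] := eqVneq c ord0; last exact: clad0_flip.
  by case: b; [exact: clad0_cap | rewrite clad0E].
have N0 := clad0_None; have N1 := cladS_None 0; have N2 := cladS_None 1.
move: (clad 0) (clad 1) (clad 2) E0 E1 E2 N0 N1 N2 => r0 r1 r2 E0 E1 E2 N0 N1 N2.
have i01 := i10; rewrite eq_sym in i01; have i02 := i20; rewrite eq_sym in i02.
have i12 := i21; rewrite eq_sym in i12.
apply/permP=> x; rewrite c3E ?(inj_eq Some_injective) ?xpair_eqE ?i01 ?i02 ?i12 //.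
rewrite !permM.
have simp := (E0, E1, E2, N0, N1, N2, i10, i20, i21, i01, i02, i12, eqxx).
case: x => [[c b]|]; last by rewrite ?(simp, fun_if).
rewrite !(inj_eq Some_injective) !xpair_eqE.
have [->|c0] := eqVneq c ord0; first by case: b; do !rewrite ?simp /=.
have [->|c1] := eqVneq c (inord 1); first by case: b; do !rewrite ?simp /=.
have [->|c2] := eqVneq c (inord 2); first by case: b; do !rewrite ?simp /=.
by do 12!rewrite ?simp ?(negPf c0) ?(negPf c1) ?(negPf c2) /=; rewrite ?negbK.
Qed.

Lemma clad_realized : realized s.+1 clad.
Proof.
have i1 : (ord0 : C) != inord 1 by rewrite -val_eqE /= inordK //; lia.
split; first exact: clad_stringC.
apply/eqP; rewrite eqEsubset; apply/andP; split.
  by apply: itv_sub => i _ si; rewrite Alt_even clad_even.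
have cq i : i < 3 -> clad i \in itv_group clad 0 s.+1.
  by move=> i3; apply: mem_itv => //; lia.
apply: (Alt_sub_c3 clad_tr) => i si.
have c3q : c3 (Some (ord0 : C, false)) (Some (inord 1, false)) (Some (inord 2, true)) \in itv_group clad 0 s.+1.
  have hq := groupM (groupM (groupM (groupM (groupM (cq 0 isT) (cq 1%N isT))
    (cq 2 isT)) (cq 1%N isT)) (cq 0 isT)) (cq 1%N isT).
  by rewrite -clad_c3; exact: (groupM hq hq).
have refl x : c3_rel (itv_group clad 0 s.+1) x x by apply/c3_relP; left.
(* The base point (0, false) is moved by [clad 1] alone, so one 3-cycle suffices. *)
case: i si => [|[|i]] si; first by rewrite clad0E ?addbF //.
  have -> : clad 1 (Some (ord0, false)) = Some (inord 1, false).
    rewrite cladSE /adj (_ : inord 0 = ord0) ?tpermL //.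
    by apply: val_inj; rewrite /= inordK.
  have n1 : Some (ord0 : C, false) != Some (inord 1, false).
    by rewrite (inj_eq Some_injective) xpair_eqE andbT i1.
  have n (c c' : C) : Some (c, false) != Some (c', true).
    by rewrite (inj_eq Some_injective) xpair_eqE andbF.
  by have [h _ _] := c3_rel_mem n1 (n _ _) (n _ _) c3q.
by rewrite cladSE adj_out.
Qed.
End CappedLadder.

(** * Assembly *)

Definition representable n r :=
  exists rho : 'I_r -> {perm 'I_n}, string_C_group ('Alt_('I_n)) rho.

Lemma contract_representable (X : finType) n r m (rho : nat -> {perm X}) : #|X| = n -> 4 < n ->
    realized (m + r) rho -> 3 <= r -> (forall i, i < m -> odd #[rho i.+2 * rho i.+3]) ->
  representable n r.
Proof.
move=> cX n5 real r3 odd_m; have [||s] := realized_contract _ real _ odd_m.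
- by rewrite cX.
- by rewrite -addn3 leq_add2l.
by rewrite addKn; apply: realized_ord.
Qed.

Section Wedge.
Variables (Y Z : finType) (v : Y) (w : Z) (k s : nat).
Variables (t : nat -> {perm Y}) (q : nat -> {perm Z}).
Hypotheses (tP : piece setT v k t) (qP : piece setT w s q).
Variables (n r m : nat).
Hypotheses (cn : #|Y| + #|Z| = n.+1) (n5 : 4 < n) (r3 : 3 <= r) (mr : m + r = k + s).

Lemma wedge_representable :
    (forall i, i < m -> odd #[wedge_gens v w k t q i.+2 * wedge_gens v w k t q i.+3]) ->
  representable n r.
Proof.
apply: contract_representable => //; last by rewrite mr; apply: wedgeP.
by apply: succn_inj; rewrite -cn; apply: card_wedge.
Qed.

Lemma wedgel_representable : (0 < m -> m.+2 < k) ->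
    (forall a, k < a + m.+4 -> a.+1 < k -> odd #[t a * t a.+1]) -> representable n r.
Proof.
move=> mk odd_t; apply: wedge_representable => i im; rewrite order_wedgel; last by lia.
have -> : k.-1 - i.+2 = (k.-1 - i.+3).+1 by lia.
set a := k.-1 - i.+3; have -> : #[t a.+1 * t a] = #[t a * t a.+1].
  by rewrite -(orderJ _ (t a.+1)) conjgE !mulgA mulVg mul1g.
by apply: odd_t; rewrite /a; lia.
Qed.

Lemma wedger_representable : k = 2 -> (forall i, i < m -> odd #[q i * q i.+1]) -> representable n r.
Proof.
move=> k2 odd_q; apply: wedge_representable => i im; rewrite order_wedger ?k2 // !subSS !subn0.
exact: odd_q.
Qed.
End Wedge.

(** Since the path has rank two, the products needed for contraction, which start at index 2, are
    exactly those of consecutive generators of [q]. *)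
Lemma path_representable (Z : finType) (w : Z) s q t n r m :
    piece setT w s q -> #|Z| + (4 * t).+4 = n -> 3 <= r -> m + r = s.+2 ->
    (forall i, i < m -> odd #[q i * q i.+1]) -> representable n r.
Proof.
move=> qP cn r3 mr; apply: (wedger_representable (path_piece t) qP) => //.
- by rewrite card_ord -cn addSn addnC.
- by rewrite -cn; have : 0 < #|Z| by [apply/card_gt0P; exists w]; lia.
Qed.

(** The ladder is glued in reverse and contracted from its far end. The product
    [lad0 k 0 * lad0 k 1] has order 6 and must not be reached, which leaves the ranks from [s.+4]
    on. *)
Lemma ladder_representable (Z : finType) (w : Z) s q k n r : piece setT w s q ->
    odd k -> 2 < k -> #|Z| + (k.*2).+1 = n -> s.+4 <= r -> r <= k + s ->
  representable n r.
Proof.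
move=> qP ko k3 cn sr rk; apply: (wedgel_representable (m := k + s - r) (lad0_piece ko k3) qP);
  rewrite ?card_prod ?card_bool ?card_ord; try lia.
by move=> a ka ak; apply: lad0_odd_order => //; lia.
Qed.

Theorem theorem1p1 (n r : nat) :
  12 <= n -> 3 <= r -> r <= (n - 1) %/ 2 ->
  exists rho : 'I_r -> {perm 'I_n}, string_C_group (Alt 'I_n) rho.
Proof.
move=> n12 r3 rn; rewrite -/(representable n r).
have nE := divn_eq n 4; have n4 := ltn_pmod n (isT : 0 < 4).
move: nE n4; set d := n %/ 4; case: (n %% 4) => [|[|[|[|//]]]] nE _.
(* Degree 4d: a ladder on 2d-2 columns and a path of five points, of rank 2d-1. *)
- have [r6|r6] := leqP 6 r.
    by apply: (ladder_representable (k := d.*2 - 3) (path_piece 0)); rewrite ?card_ord; lia.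
  have [r5|r5] := eqVneq r 5.
    rewrite r5; apply: (path_representable (t := d - 3) (m := 0) (lad0_piece (s := 3) isT isT)) => //.
    by rewrite card_prod card_bool card_ord; lia.
  (* The icosahedron with a path has rank 5 and at least 16 points, the path having at least
     five. *)
  have [n16|n16] := leqP 16 n.
    apply: (path_representable (t := d - 4) (m := 5 - r) ico_piece); rewrite ?card_ord; try lia.
    by move=> i im; apply: ico_odd; lia.
  have -> : n = 12 by lia.
  apply: (contract_representable (m := 4 - r) (card_ord 12)) => //.
    by rewrite subnK; [exact: deg12_realized | lia].
  by move=> i im; have -> : i = 0 by [lia]; apply: deg12_odd.
(* Degree 4d+1: 2d columns and the extra point, rank 2d. *)
- have [s_odd s3] : odd (d.*2 - 1) /\ 2 < d.*2 - 1 by split; lia.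
  apply: (contract_representable (m := d.*2 - r) (X := option ('I_(d.*2 - 1).+1 * bool)%type)
    (rho := clad (d.*2 - 1))) => //.
  + by rewrite card_option card_prod card_bool card_ord; lia.
  + by lia.
  + by have -> : d.*2 - r + r = (d.*2 - 1).+1 by [lia]; apply: clad_realized.
  by move=> i im; apply: clad_odd_order; lia.
(* Degree 4d+2: the ladder on 2d-1 columns with a short path has rank 2d. Contraction may not touch
   the twisted [lad1 1], whence the bound 7. *)
- have [r7|r7] := leqP 7 r.
    have [s_odd s3] : odd (d.*2 - 3) /\ 2 < d.*2 - 3 by split; lia.
    apply: (wedgel_representable (m := d.*2 - r) (lad1_piece s_odd s3) (path_piece 0)); try lia.
      by rewrite card_prod card_bool !card_ord; lia.
    by move=> a ka ak; apply: lad1_odd_order => //; lia.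
  have [r6|r6] := eqVneq r 6.
    rewrite r6; apply: (path_representable (t := d - 3) (m := 0) (lad1_piece (s := 3) isT isT)) => //.
    by rewrite card_prod card_bool card_ord; lia.
  apply: (path_representable (t := d - 2) (m := 5 - r) hemiico_piece); rewrite ?card_ord; try lia.
  by move=> i im; apply: hemiico_odd; lia.
- have [r6|r6] := leqP r 6.
    apply: (path_representable (t := d - 3) (m := 6 - r) cell11_piece); rewrite ?card_ord; try lia.
    by move=> i im; apply: cell11_odd; lia.
  (* Degree 4d+3: the hemi-icosahedron with a ladder on 2d-1 columns reaches the top rank 2d+1. A
     ladder on 2d-2 columns with the cube has rank 2d and contracts down to 7. *)
  have [rE|rE] := eqVneq r d.*2.+1.
    have [s_odd s3] : odd (d.*2 - 3) /\ 2 < d.*2 - 3 by split; lia.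
    apply: (wedge_representable (m := 0) hemiico_piece (lad1_piece s_odd s3)) => //; try lia.
    by rewrite card_prod card_bool !card_ord; lia.
  by apply: (ladder_representable (k := d.*2 - 3) cube_piece); rewrite ?card_ord; lia.
Qed.
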